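(* Let $\Omega\subset\mathbb{R}^d$ be a bounded domain having a uniform exterior ball of radius $r>0$. Let $P_{\partial\Omega}$ denote (a Borel selector of) the projection onto $\partial\Omega$, $P_{\partial\Omega}(x)\in\mathrm{argmin}\{|x-y|:y\in\partial\Omega\}$. There is a constant $C=C(d,r,\mathrm{diam}(\Omega))$ such that for every $f\ge0$ with $f\in L^\infty(\Omega)$, the transport density $\sigma$ between $f$ and $(P_{\partial\Omega})_\#f$ satisfies $$\sigma(y)\le\frac{C\,\|f\|_{L^\infty(\Omega)}}{(r+d(y,\partial\Omega))^{d-1}}\qquad\text{for a.e. }y\in\Omega.$$ Moreover, for $p\in[1,+\infty]$, if $f\ge 0$ and $f\in L^p(\Omega)$, then the transport density $\sigma$ between $f$ and $(P_{\partial\Omega})_\#f$ belongs to $L^p(\Omega)$.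
   Context: $\Omega$ has a uniform exterior ball of radius $r>0$ if for every $y\in\partial\Omega$ there is $x\in\mathbb{R}^d$ with $B(x,r)\cap\Omega=\emptyset$ and $|x-y|=r$. $d(y,\partial\Omega)$ is the Euclidean distance from $y$ to $\partial\Omega$. The function $f$ is identified with the measure $f\,dx$. The transport density $\sigma$ between $f$ and $(P_{\partial\Omega})_\#f$ is the positive measure on $\bar\Omega$ defined by $$\langle\sigma,\phi\rangle=\int_{\Omega}\int_0^1|x-P_{\partial\Omega}(x)|\,\phi\big((1-t)x+tP_{\partial\Omega}(x)\big)\,f(x)\,dt\,dx\qquad\text{for all }\phi\in C(\bar\Omega);$$ it is identified with its density with respect to Lebesgue measure. *)

(* Defs.v *)
From HB Require Import structures.
From mathcomp Require Import all_boot all_order all_algebra.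
From mathcomp Require Import all_classical all_reals all_analysis.
From mathcomp Require Import measurable_realfun.

Set Implicit Arguments.
Unset Strict Implicit.
Unset Printing Implicit Defensive.

Import Order.TTheory GRing.Theory Num.Theory.
Import numFieldNormedType.Exports.

Local Open Scope classical_set_scope.
Local Open Scope ring_scope.

(* R^n is 'rV[R]_n, with the topology of the library.  It is given the        *)
(* sigma-algebra generated by the coordinates, as the library does for        *)
(* n.-tuple; rV_measurableE below shows that it is the Borel sigma-algebra.   *)
Section rV_measurable.
Variables (R : realType) (n : nat).

Let coord (i : 'I_n) (v : 'rV[R]_n) : R := v ord0 i.

Let rV_set0 : g_sigma_preimage coord set0.
Proof. exact: sigma_algebra0. Qed.

Let rV_setC A : g_sigma_preimage coord A -> g_sigma_preimage coord (~` A).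
Proof. exact: sigma_algebraC. Qed.

Let rV_bigcup (F : _^nat) : (forall i, g_sigma_preimage coord (F i)) ->
  g_sigma_preimage coord (\bigcup_i (F i)).
Proof. exact: sigma_algebra_bigcup. Qed.

HB.instance Definition _ := @isMeasurable.Build
  (measure_tuple_display default_measure_display)
  'rV[R]_n (g_sigma_preimage coord) rV_set0 rV_setC rV_bigcup.

Lemma measurable_coord (i : 'I_n) :
  measurable_fun [set: 'rV[R]_n] (fun v : 'rV[R]_n => v ord0 i).
Proof.
move=> _ Y mY; rewrite setTI; apply: sub_sigma_algebra => /=.
rewrite -bigcup_seq/=; exists i => /=; first by rewrite mem_index_enum.
by exists Y => //; rewrite setTI.
Qed.

Lemma measurable_fun_rV d (T : measurableType d) (f : T -> 'rV[R]_n) :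
  (forall i, measurable_fun [set: T] (fun x => f x ord0 i)) ->
  measurable_fun [set: T] f.
Proof.
move=> mf _ A mA.
suff : g_sigma_preimage (fun i => coord i \o f) `<=` (@measurable _ T).
  by rewrite g_sigma_preimage_comp; apply; exists A.
apply: smallest_sub; first exact: sigma_algebra_measurable.
case: n f mf {A mA} @coord rV_set0 rV_setC rV_bigcup => [|m] f mf ? _ _ _.
  by rewrite big_ord0.
rewrite -bigcup_mkord_ord; apply: bigcup_sub => i Ii.
by move=> A [B mB <-]; exact: mf.
Qed.

Let ratV (q : 'rV[rat]_n) : 'rV[R]_n := map_mx ratr q.

Let measurable_ball (v : 'rV[R]_n) (e : R) : 0 < e ->
  (@measurable _ 'rV[R]_n) (ball v e).
Proof.
move=> e0; rewrite (_ : ball v e =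
  \bigcap_(i in [set: 'I_n]) (coord i @^-1` ball (v ord0 i) e)).
  apply: fin_bigcap_measurable => // i _.
  rewrite -[X in measurable X]setTI; apply: measurable_coord => //.
  by apply: open_measurable; exact: ball_open.
apply/seteqP; split => [w [_ vw] i _|w vw]; first exact: vw.
by split=> // i j; rewrite ord1; exact: vw.
Qed.

Lemma measurable_rV_open (U : set 'rV[R]_n) : open U -> measurable U.
Proof.
move=> oU.
pose F (p : 'rV[rat]_n * nat) : set 'rV[R]_n :=
  if `[< ball (ratV p.1) p.2.+1%:R^-1 `<=` U >]
  then ball (ratV p.1) p.2.+1%:R^-1 else set0.
rewrite (_ : U = \bigcup_p F p).
  apply: countable_bigcupT_measurable => // p; rewrite /F; case: ifPn => // _.
  by apply: measurable_ball; rewrite invr_gt0.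
apply/seteqP; split => [v Uv|v [p _]]; last first.
  by rewrite /F; case: asboolP => // + bv; exact.
have /nbhs_ballP[e /= e0 eU] : nbhs v U by exact: open_nbhs_nbhs.
have [k ke] : exists k : nat, (k.+1%:R^-1 : R) < e / 2.
  have e20 : 0 < e / 2 by rewrite divr_gt0.
  have [N _ HN] := near_infty_natSinv_lt (PosNum e20).
  by exists N; apply: HN => /=.
have k0 : 0 < (k.+1%:R^-1 : R) by rewrite invr_gt0.
have qE i : {q : rat | ball (v ord0 i) (k.+1%:R^-1) (ratr q : R)}.
  apply: cid.
  have /rat_in_itvoo[q qv] : v ord0 i < v ord0 i + k.+1%:R^-1 by rewrite ltrDl.
  exists q; move: qv; rewrite in_itv/= => /andP[q1 q2].
  by rewrite /ball/= distrC ger0_norm ?subr_ge0 1?ltW// ltrBlDl.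
exists (\row_i sval (qE i), k) => //; rewrite /F/=.
have vq : ball v (k.+1%:R^-1) (ratV (\row_i sval (qE i))).
  by split=> // i j; rewrite ord1 !mxE; case: (qE j).
case: asboolP => [_|nU]; first exact: ball_sym.
case: nU => w qw; apply: eU.
have : ball v (k.+1%:R^-1 + k.+1%:R^-1) w by exact: ball_triangle qw.
by apply: le_ball; rewrite [leRHS](splitr e) lerD// ltW.
Qed.

Lemma rV_measurableE : @measurable _ 'rV[R]_n = <<s @open 'rV[R]_n >>.
Proof.
apply/seteqP; split; last first.
  apply: smallest_sub; first exact: sigma_algebra_measurable.
  exact: measurable_rV_open.
pose T := g_sigma_algebraType (@open 'rV[R]_n).
suff /(_ measurableT) H : measurable_fun [set: T] (id : T -> 'rV[R]_n).
  by move=> A /H; rewrite setTI.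
apply: measurable_fun_rV => i.
apply: (measurability (@RGenOpens.G R)); first exact: RGenOpens.measurableE.
move=> _ [_ [x [y ->]] <-]; rewrite setTI; apply: sub_sigma_algebra.
apply: open_comp => [v _|]; first exact: coord_continuous.
exact: itv_open.
Qed.

End rV_measurable.

Section lebesgue_measure_rV.
Variable R : realType.
Local Open Scope ereal_scope.

Definition rV_cons n (p : R * 'rV[R]_n) : 'rV[R]_n.+1 := row_mx p.1%:M p.2.

Lemma rV_cons0 n (p : R * 'rV[R]_n) : rV_cons p ord0 ord0 = p.1.
Proof.
have := row_mxEl (p.1%:M : 'rV_1) p.2 ord0 ord0; rewrite [RHS]mxE mulr1n => <-.
by congr (row_mx _ _ _ _); exact/val_inj.
Qed.

Lemma rV_consS n (p : R * 'rV[R]_n) i :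
  rV_cons p ord0 (lift ord0 i) = p.2 ord0 i.
Proof.
have <- := row_mxEr (p.1%:M : 'rV_1) p.2 ord0 i.
by congr (row_mx _ _ _ _); exact/val_inj.
Qed.

Lemma measurable_rV_cons n :
  measurable_fun [set: R * 'rV[R]_n] (@rV_cons n).
Proof.
apply: measurable_fun_rV => i; have [j ->|->] := unliftP ord0 i.
  under eq_fun do rewrite rV_consS.
  apply: (measurableT_comp (measurable_coord j)); exact: measurable_snd.
by under eq_fun do rewrite rV_cons0; exact: measurable_fst.
Qed.

Let rV_uncons n (v : 'rV[R]_n.+1) : R * 'rV[R]_n :=
  (v ord0 ord0, \row_i v ord0 (lift ord0 i)).

Let measurable_rV_uncons n :
  measurable_fun [set: 'rV[R]_n.+1] (@rV_uncons n).
Proof.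
apply/measurable_fun_pairP; split; first exact: measurable_coord.
apply: measurable_fun_rV => i.
by under eq_fun do rewrite mxE; exact: measurable_coord.
Qed.

Let rV_consK n : cancel (@rV_cons n) (@rV_uncons n).
Proof.
move=> [x v]; rewrite /rV_uncons rV_cons0; congr (_, _).
by apply/rowP => i; rewrite mxE rV_consS.
Qed.

Section step.
Variables (n : nat) (m : {sigma_finite_measure set 'rV[R]_n -> \bar R}).

Definition lebesgue_rV_step : set 'rV[R]_n.+1 -> \bar R :=
  pushforward (lebesgue_measure \x m) (@rV_cons n).

Let step0 : lebesgue_rV_step set0 = 0.
Proof. by rewrite /lebesgue_rV_step /pushforward preimage_set0 measure0. Qed.

Let step_ge0 A : 0 <= lebesgue_rV_step A.
Proof. exact: (measure_ge0 (lebesgue_measure \x m)). Qed.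

Let step_sigma_additive : semi_sigma_additive lebesgue_rV_step.
Proof.
pose mu := measure_function_pushforward__canonical__measure_function_Measure
  (lebesgue_measure \x m)%E (@measurable_rV_cons n).
exact: (@measure_semi_sigma_additive _ _ _ mu).
Qed.

HB.instance Definition _ := isMeasure.Build _ _ _ lebesgue_rV_step
  step0 step_ge0 step_sigma_additive.

Let step_sigma_finite : sigma_finite setT lebesgue_rV_step.
Proof.
have /sigma_finiteP[F [TF ndF Foo]] := sigma_finiteT (@lebesgue_measure R).
have /sigma_finiteP[G [TG ndG Goo]] := sigma_finiteT m.
exists (fun k => @rV_uncons n @^-1` (F k `*` G k)).
  rewrite -preimage_bigcup (_ : \bigcup_k _ = setT) ?preimage_setT//.
  apply/seteqP; split => // -[x v] _.
  have [i _ Fix] : (\bigcup_k F k) x by rewrite -TF.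
  have [j _ Gjv] : (\bigcup_k G k) v by rewrite -TG.
  exists (maxn i j) => //; split => /=.
  - by move: x Fix; exact/subsetPset/ndF/leq_maxl.
  - by move: v Gjv; exact/subsetPset/ndG/leq_maxr.
move=> k; have [mF Fk] := Foo k; have [mG Gk] := Goo k; split.
  rewrite -[X in measurable X]setTI; apply: measurable_rV_uncons => //.
  exact: measurableX.
rewrite /lebesgue_rV_step /pushforward -comp_preimage.
rewrite (_ : _ \o _ = id); last by apply/funext; exact: rV_consK.
by rewrite preimage_id product_measure1E// lte_mul_pinfty// ge0_fin_numE.
Qed.

HB.instance Definition _ := Measure_isSigmaFinite.Build _ _ _ lebesgue_rV_step
  step_sigma_finite.

End step.

Fixpoint lebesgue_rV n : {sigma_finite_measure set 'rV[R]_n -> \bar R} :=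
  match n with
  | 0%N => \d_(0%R : 'rV[R]_0)
  | n'.+1 => lebesgue_rV_step (lebesgue_rV n')
  end.

Lemma lebesgue_rV_box n (A : 'I_n -> set R) :
  (forall i, measurable (A i)) ->
  lebesgue_rV n [set v | forall i, A i (v ord0 i)] =
  \prod_(i < n) lebesgue_measure (A i).
Proof.
elim: n A => [|n IHn] A mA.
  by rewrite big_ord0/= diracE mem_set// => -[].
pose B := [set v : 'rV[R]_n | forall i, A (lift ord0 i) (v ord0 i)].
have mB : measurable B.
  rewrite (_ : B = \bigcap_(i in [set: 'I_n])
      ((fun v : 'rV[R]_n => v ord0 i) @^-1` A (lift ord0 i))).
    apply: fin_bigcap_measurable => // i _.
    by rewrite -[X in measurable X]setTI; exact: measurable_coord.
  by apply/seteqP; split => v H i; [move=> _; exact: H | exact: (H i I)].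
rewrite big_ord_recl -IHn// -product_measure1E//=; last exact: mA.
rewrite /lebesgue_rV_step /pushforward; congr (_ _).
apply/seteqP; split => [[x v]/= H|[x v]/= [Hx Hv] i].
  split => [|i]; first by have := H ord0; rewrite rV_cons0.
  by have := H (lift ord0 i); rewrite rV_consS.
by have [j ->|->] := unliftP ord0 i; rewrite ?rV_consS ?rV_cons0.
Qed.

End lebesgue_measure_rV.

Section transport_density.
Variables (R : realType) (n : nat).
Implicit Types (x y z : 'rV[R]_n) (A Omega : set 'rV[R]_n) (r : R).

(* The norm `|x| of the library is the sup norm, hence these Euclidean        *)
(* versions of the norm, ball, distance to a set and diameter.  The last two  *)
(* are real-valued, hence meaningful only for a nonempty set and a nonempty   *)
(* bounded set respectively.                                                  *)
Definition enorm x : R := Num.sqrt (\sum_(i < n) x ord0 i ^+ 2).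

Definition eball x r : set 'rV[R]_n := [set z | enorm (z - x) < r].

Definition edist_set y A : R := inf [set enorm (y - z) | z in A].

Definition ediam A : R := sup [set enorm (x - y) | x in A & y in A].

Definition boundary A : set 'rV[R]_n := closure A `\` A°.

Definition bounded_domain Omega :=
  [/\ Omega !=set0, open Omega, connected Omega & bounded_set Omega].

Definition uniform_exterior_ball Omega r :=
  forall y, boundary Omega y ->
    exists x, eball x r `&` Omega = set0 /\ enorm (x - y) = r.

Definition borel_projection_selector Omega (P : 'rV[R]_n -> 'rV[R]_n) :=
  measurable_fun Omega P /\
  forall x, Omega x -> boundary Omega (P x) /\
    forall y, boundary Omega y -> enorm (x - P x) <= enorm (x - y).

(* f \_ Omega is the extension of the restriction of f to Omega by 0.         *)
Definition Lp_on Omega (p : \bar R) (f : 'rV[R]_n -> R) : Prop :=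
  (f \_ Omega) \in Lfun (lebesgue_rV R n) p.

Definition Lp_norm_on Omega (p : \bar R) (f : 'rV[R]_n -> R) : \bar R :=
  'N[lebesgue_rV R n]_p [EFin \o (f \_ Omega)].

(* Measures on closure Omega are measures on R^n that do not charge its       *)
(* complement.                                                                *)
Definition is_transport_density Omega (P : 'rV[R]_n -> 'rV[R]_n)
    (f : 'rV[R]_n -> R) (sigma : {measure set 'rV[R]_n -> \bar R}) :=
  (sigma (~` closure Omega) = 0)%E /\
  forall phi : 'rV[R]_n -> R, {within closure Omega, continuous phi} ->
    (\int[sigma]_(z in closure Omega) (phi z)%:E =
     \int[lebesgue_rV R n]_(x in Omega)
       \int[lebesgue_measure]_(t in `[0%R, 1%R])
         (enorm (x - P x) * phi ((1 - t) *: x + t *: P x) * f x)%:E)%E.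

Definition is_lebesgue_density (sigma : {measure set 'rV[R]_n -> \bar R})
    (s : 'rV[R]_n -> R) :=
  [/\ measurable_fun [set: 'rV[R]_n] s, (forall y, 0 <= s y) &
    forall A, measurable A ->
      sigma A = (\int[lebesgue_rV R n]_(y in A) (s y)%:E)%E].

End transport_density.

(* Main.v *)
Require Import Defs.
From HB Require Import structures.
From mathcomp Require Import all_boot all_order all_algebra.
From mathcomp Require Import all_classical all_reals all_analysis.
From mathcomp Require Import measurable_realfun ess_sup_inf ring lra.

Set Implicit Arguments.
Unset Strict Implicit.
Unset Printing Implicit Defensive.

Import Order.TTheory GRing.Theory Num.Theory.
Import numFieldNormedType.Exports.

Local Open Scope classical_set_scope.
Local Open Scope ring_scope.

(* Since r + d(y, bd Omega) lies between r and r + diam Omega, the weight only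
   changes the constant, and it suffices to bound the density.
   Parametrize the transport rays by arc length: x moves to
   S_s(x) = x + s (Px - x)/|Px - x|, 0 <= s < |Px - x|.  If c is the center of
   the exterior ball at Px, then x, Px and c are aligned and every x' in Omega
   satisfies |x' - c| >= d(x', bd Omega) + r; comparing two points through
   these inequalities gives |S_s x - S_s x'| >= r/(r + diam) |x - x'|.  Hence the
   preimage under S_s of a cube of side l lies in a cube of side of order l, and
   the image of Lebesgue measure under (s, x) |-> S_s(x) is at most C times
   Lebesgue measure on dyadic cubes, so on all Borel sets.  The transport
   density is the image of f(x) ds dx, which settles p = oo.  For p < oo write
   b for the density s cut off outside {s <= k}; then
   int b^p = int b(S)^(p-1) f <= eps int b(S)^p + eps^(1-p) int f^p
           <= eps C int b^p + eps^(1-p) diam int f^p,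
   and the first term is absorbed. *)

(** * Euclidean geometry *)

(** [P] is only a Borel map and may jump where the projection is not unique, so no change of
    variables along the rays is at hand. One metric fact replaces it: at a fixed time the ray map
    shrinks distances by at most a constant factor. This uses no continuity of [P], and the factor
    stays away from 0 up to the arrival time because the exterior centers lie at distance r beyond
    the boundary. Such a fact controls preimages of sets of known diameter only, whence the cubes.
    The passage from cubes to Borel sets is not a pi-lambda argument, since an inequality between
    measures is not stable under complement; Borel sets are approximated in measure by unions of
    cubes, which asks for finite measures and hence for a large cube around Omega. For unbounded f
    no multiple of Lebesgue measure is known beforehand to dominate the transport density, so its
    absolute continuity is proved separately, on null sets. The absorption for p < oo compares an
    integral with half of itself, which says nothing if the integral is infinite; the cutoff at
    level k makes it finite, and the resulting bound does not depend on k. *)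

Section euclidean.
Context {R : realType} {d : nat}.
Implicit Types (u v w x y z : 'rV[R]_d) (a b : R).

Definition edot u v : R := \sum_(i < d) u ord0 i * v ord0 i.

Lemma edotC u v : edot u v = edot v u.
Proof. by apply: eq_bigr => i _; rewrite mulrC. Qed.

Lemma edotDl u v w : edot (u + v) w = edot u w + edot v w.
Proof. by rewrite -big_split; apply: eq_bigr => i _; rewrite mxE mulrDl. Qed.

Lemma edotZl a u w : edot (a *: u) w = a * edot u w.
Proof. by rewrite mulr_sumr; apply: eq_bigr => i _; rewrite mxE mulrA. Qed.

Lemma edotDr u v w : edot w (u + v) = edot w u + edot w v.
Proof. by rewrite !(edotC w) edotDl. Qed.

Lemma edotZr a u w : edot w (a *: u) = a * edot w u.
Proof. by rewrite !(edotC w) edotZl. Qed.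

Lemma edotNl u w : edot (- u) w = - edot u w.
Proof. by rewrite -scaleN1r edotZl mulN1r. Qed.

Lemma edotNr u w : edot w (- u) = - edot w u.
Proof. by rewrite -scaleN1r edotZr mulN1r. Qed.

Lemma edot_ge0 u : 0 <= edot u u.
Proof. by apply: sumr_ge0 => i _; rewrite -expr2 sqr_ge0. Qed.

Lemma edot_eq0 u : edot u u = 0 -> u = 0.
Proof.
move=> /eqP; rewrite psumr_eq0; last by move=> i _; rewrite -expr2 sqr_ge0.
move=> /allP u0; apply/rowP => i; rewrite mxE.
by have := u0 i; rewrite mem_index_enum => /(_ isT); rewrite mulf_eq0 orbb => /eqP.
Qed.

Definition edotE := (edotDl, edotDr, edotNl, edotNr, edotZl, edotZr).

Lemma enormE u : enorm u = Num.sqrt (edot u u).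
Proof. by congr Num.sqrt; apply: eq_bigr => i _; rewrite expr2. Qed.

Lemma enorm_ge0 u : 0 <= enorm u. Proof. exact: sqrtr_ge0. Qed.

Lemma sqr_enorm u : enorm u ^+ 2 = edot u u.
Proof. by rewrite enormE sqr_sqrtr ?edot_ge0. Qed.

Lemma enormZ a u : enorm (a *: u) = `|a| * enorm u.
Proof. by rewrite !enormE edotZl edotZr mulrA -expr2 sqrtrM ?sqr_ge0// sqrtr_sqr. Qed.

Lemma enormN u : enorm (- u) = enorm u.
Proof. by rewrite -scaleN1r enormZ normrN1 mul1r. Qed.

Lemma enorm_distC u v : enorm (u - v) = enorm (v - u).
Proof. by rewrite -enormN opprB. Qed.

Lemma enorm0 : enorm (0 : 'rV[R]_d) = 0.
Proof. by rewrite -[0 in LHS](scale0r 0) enormZ normr0 mul0r. Qed.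

Lemma enorm_eq0 u : enorm u = 0 -> u = 0.
Proof. by move=> u0; apply: edot_eq0; rewrite -sqr_enorm u0 expr0n. Qed.

Lemma edot_le u v : edot u v <= enorm u * enorm v.
Proof.
have [u0|u0] := eqVneq (enorm u) 0.
  by rewrite u0 mul0r (enorm_eq0 u0) -[0](scale0r 0) edotZl mul0r.
have [v0|v0] := eqVneq (enorm v) 0.
  by rewrite v0 mulr0 (enorm_eq0 v0) -[0](scale0r 0) edotZr mul0r.
have up : 0 < enorm u by rewrite lt_def u0 enorm_ge0.
have vp : 0 < enorm v by rewrite lt_def v0 enorm_ge0.
have := edot_ge0 (enorm v *: u - enorm u *: v).
rewrite !edotE -!sqr_enorm (edotC v u) => H.
rewrite -(ler_pM2l (mulr_gt0 up vp)); nra.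
Qed.

Lemma ler_enormD u v : enorm (u + v) <= enorm u + enorm v.
Proof.
rewrite -ler_sqr ?nnegrE ?addr_ge0 ?enorm_ge0//.
rewrite sqr_enorm !edotE (edotC v u) -!sqr_enorm.
have := edot_le u v; nra.
Qed.

Lemma ler_enorm_dist u v w : enorm (u - w) <= enorm (u - v) + enorm (v - w).
Proof. by rewrite (le_trans _ (ler_enormD _ _))// addrA subrK. Qed.

Lemma ler_coord_enorm u i : `|u ord0 i| <= enorm u.
Proof.
rewrite -ler_sqr ?nnegrE ?enorm_ge0// sqr_enorm real_normK ?num_real//.
rewrite /edot (bigD1 i)//= -expr2 lerDl sumr_ge0// => j _.
by rewrite -expr2 sqr_ge0.
Qed.

(** The factor d, instead of its square root, comes from the triangle inequality applied to the
    coordinate expansion; it reappears in [ray_section_const]. *)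
Lemma ler_enorm_coord u a : 0 <= a -> (forall i, `|u ord0 i| <= a) ->
  enorm u <= d%:R * a.
Proof.
move=> a0 ua; have -> : u = \sum_(i < d) u ord0 i *: 'e_i.
  by rewrite {1}(matrix_sum_delta u) big_ord1.
rewrite mulr_natl -[in X in _ <= X](card_ord d) -sumr_const.
apply: (big_ind2 (fun v b => enorm v <= b)).
- by rewrite enorm0.
- move=> v b w c vb wc; rewrite (le_trans (ler_enormD _ _))// lerD//.
- move=> i _; rewrite enormZ.
  suff -> : enorm ('e_i : 'rV[R]_d) = 1 by rewrite mulr1.
  rewrite enormE /edot (bigD1 i)//= big1 ?addr0 ?mxE ?eqxx ?mulr1 ?sqrtr1//.
  by move=> j ji; rewrite mxE eq_sym (negbTE ji) andbF mulr0.
Qed.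

Lemma ltr_enorm_nbhs x e : 0 < e -> \forall y \near x, enorm (y - x) < e.
Proof.
(* Dividing by d + 1 rather than d keeps the radius meaningful for d = 0 and makes the final
   inequality d / (d + 1) < 1 strict. *)
move=> e0; have ed : 0 < e / d.+1%:R by rewrite divr_gt0.
apply/nbhs_ballP; exists (e / d.+1%:R) => //= y [_ xy].
apply: (@le_lt_trans _ _ (d%:R * (e / d.+1%:R))).
  apply: ler_enorm_coord => [|i]; first exact: ltW.
  by have := xy ord0 i; rewrite /ball/= distrC !mxE => /ltW.
by rewrite mulrCA gtr_pMr// ltr_pdivrMr// mul1r ltr_nat.
Qed.

End euclidean.

(** * Exterior balls and the expansion estimate for rays *)

Section exterior_ball_geometry.
Context {R : realType} {d : nat}.
Implicit Types (Omega : set 'rV[R]_d) (x y z c p e w : 'rV[R]_d) (r s a : R).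

(** On the segment from x to a point w of the ball outside Omega, let t0 be the supremum of the
    parameters lying in Omega. If the point at t0 were in Omega, openness would allow a larger
    parameter; so it is a boundary point, at distance t0 |w - x| < a from x. *)
Lemma eball_sub_open Omega x a : open Omega -> Omega x ->
  (forall y, boundary Omega y -> a <= enorm (x - y)) -> eball x a `<=` Omega.
Proof.
move=> oO Ox xa w; rewrite /eball/= => wxa; apply: contrapT => nOw.
pose g (t : R) := x + t *: (w - x).
have cg : continuous g.
  by move=> t; apply: cvgD; [exact: cvg_cst|apply: cvgZr_tmp; exact: cvg_id].
pose T := [set t : R | (0 <= t <= 1) /\ Omega (g t)].
have T0 : T 0 by split; [rewrite lexx ler01|rewrite /g scale0r addr0].
have uT : ubound T 1 by move=> t [/andP[]].
set t0 := sup T.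
have t01 : 0 <= t0 <= 1.
  by apply/andP; split; [apply: ub_le_sup => //; exists 1|apply: ge_sup => //; exists 0].
have clT : closure T t0 by apply: closure_sup; [exists 0|exists 1].
have clz : closure Omega (g t0).
  move=> B /cg /clT[t [[_ Ot] Bt]]; by exists (g t).
have [Oz|nOz] := pselect (Omega (g t0)); last first.
  have /xa : boundary Omega (g t0) by split => // /interior_subset.
  rewrite /g opprD addrA subrr add0r enormN enormZ leNgt => /negP; apply.
  case/andP : t01 => t0p t1; rewrite ger0_norm// (le_lt_trans _ wxa)//.
  by rewrite ler_piMl// enorm_ge0.
have t1 : t0 < 1.
  rewrite lt_def; case/andP : t01 => _ ->; rewrite andbT; apply/eqP => t1.
  by apply: nOw; move: Oz; rewrite /g -t1 scale1r addrC subrK.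
have : \forall t \near t0, Omega (g t) by apply: cg; exact: open_nbhs_nbhs.
move=> /nbhs_ballP[e /= e0 eO].
pose t := t0 + Num.min (e / 2) (1 - t0).
have m0 : 0 < Num.min (e / 2) (1 - t0) by rewrite lt_min divr_gt0//= subr_gt0.
have Tt : T t.
  split.
    case/andP : t01 => t0p _; rewrite addr_ge0 ?(ltW m0)//=.
    by rewrite -lerBrDl ge_min lexx orbT.
  apply: eO; rewrite /ball/= /t opprD addrA subrr add0r normrN ger0_norm ?ltW//.
  by rewrite gt_min ltr_pdivrMr// ltr_pMr// ltr1n.
have : t <= t0 by apply: ub_le_sup => //; exists 1.
by rewrite /t gerDl leNgt m0.
Qed.

Lemma disjoint_eball_dist Omega x c a r : 0 < a -> 0 < r ->
  eball x a `<=` Omega -> eball c r `&` Omega = set0 -> a + r <= enorm (x - c).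
Proof.
move=> a0 r0 xO cO; rewrite leNgt; apply/negP => xc.
have ar : 0 < a + r by rewrite addr_gt0.
(* The point dividing the segment from x to c in the ratio a : r belongs to both balls as soon as |x
   - c| < a + r. *)
have : (eball c r `&` Omega) (x + (a / (a + r)) *: (c - x)); last by rewrite cO.
have h (t : R) : 0 < t -> t / (a + r) * enorm (x - c) < t.
  by move=> t0; rewrite mulrAC ltr_pdivrMr// ltr_pM2l.
split.
  rewrite /eball/= (_ : _ - c = (r / (a + r)) *: (x - c)).
    by rewrite enormZ ger0_norm ?h// ltW ?divr_gt0.
  apply/rowP => i; rewrite !mxE; field; lra.
apply: xO; rewrite /eball/= addrC addKr enormZ enorm_distC.
by rewrite ger0_norm ?h// ltW ?divr_gt0.
Qed.

(** Equality case of the triangle inequality through p. With u = x - p, w = p - c and a = |u|, the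
    hypothesis gives <u, w> >= a r, while |w - (r / a) u|^2 = 2 (r / a) (a r - <u, w>). *)
Lemma collinear_of_dist x p c r : 0 < enorm (x - p) -> 0 <= r ->
  enorm (c - p) = r -> enorm (x - p) + r <= enorm (x - c) ->
  x - c = ((enorm (x - p) + r) / enorm (x - p)) *: (x - p).
Proof.
move=> xp r0 cp xc; set a := enorm (x - p) in xp xc *.
have ua : edot (x - p) (x - p) = a ^+ 2 by rewrite -sqr_enorm.
have wr : edot (p - c) (p - c) = r ^+ 2 by rewrite -sqr_enorm enorm_distC cp.
have : (a + r) ^+ 2 <= edot (x - c) (x - c).
  by rewrite -sqr_enorm ler_sqr ?nnegrE ?enorm_ge0 ?addr_ge0// enorm_ge0.
have -> : x - c = (x - p) + (p - c) by rewrite addrA subrK.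
move: ua wr; move: (x - p) (p - c) => u w ua wr.
rewrite !edotE ua wr (edotC w u) => H.
suff /eqP : w - (r / a) *: u = 0.
  rewrite subr_eq0 => /eqP ->; apply/rowP => i; rewrite !mxE; field; lra.
apply: edot_eq0; apply/eqP; rewrite eq_le edot_ge0 andbT.
rewrite !edotE ua wr (edotC w u).
rewrite [leLHS](_ : _ = 2 * (r / a) * (a * r - edot u w)); last by field; lra.
apply: mulr_ge0_le0; last by nra.
by rewrite mulr_ge0// divr_ge0// ltW.
Qed.

(* Dividing |x1 - c0|^2 >= rho1^2 >= 2 rho0 rho1 - rho0^2 by rho0, and
   symmetrically, the sum gives the one-sided bound
   <x1 - x0, e1 - e0> <= |x1 - x0|^2 (1/rho0 + 1/rho1) / 2. *)
Lemma ray_expansion x0 x1 e0 e1 a0 a1 s k :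
  0 < a0 -> 0 < a1 -> 0 <= s -> s <= k * a0 -> s <= k * a1 ->
  enorm e0 = 1 -> enorm e1 = 1 ->
  a1 <= enorm (x1 - (x0 - a0 *: e0)) -> a0 <= enorm (x0 - (x1 - a1 *: e1)) ->
  (1 - k) * enorm (x1 - x0) <= enorm ((x1 - s *: e1) - (x0 - s *: e0)).
Proof.
move=> a00 a10 s0 sk0 sk1 n0 n1.
rewrite -ler_sqr ?nnegrE ?enorm_ge0 ?(ltW a10)// => h1.
rewrite -ler_sqr ?nnegrE ?enorm_ge0 ?(ltW a00)// => h0.
have [->|x10] := eqVneq (enorm (x1 - x0)) 0; first by rewrite mulr0 enorm_ge0.
have xp : 0 < enorm (x1 - x0) by rewrite lt_def x10 enorm_ge0.
set D := x1 - x0 in x10 xp *.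
have E0 : edot e0 e0 = 1 by rewrite -sqr_enorm n0 expr1n.
have E1 : edot e1 e1 = 1 by rewrite -sqr_enorm n1 expr1n.
have -> : (x1 - s *: e1) - (x0 - s *: e0) = D - s *: (e1 - e0).
  by apply/rowP => i; rewrite !mxE; ring.
move: h1 h0.
have -> : x1 - (x0 - a0 *: e0) = D + a0 *: e0.
  by apply/rowP => i; rewrite !mxE; ring.
have -> : x0 - (x1 - a1 *: e1) = a1 *: e1 - D.
  by apply/rowP => i; rewrite !mxE; ring.
clearbody D; rewrite !sqr_enorm !edotE E0 E1 (edotC e0) (edotC e1) => h1 h0.
set n := edot D D in h1 h0; set p := edot D e0 in h1 h0.
set q := edot D e1 in h1 h0.
have n_ge0 : 0 <= n by exact: edot_ge0.
have h1' : 2 * a1 - 2 * a0 <= n / a0 + 2 * p.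
  rewrite -(ler_pM2r a00) [leRHS]mulrDl divfK ?gt_eqF//; have := sqr_ge0 (a1 - a0); nra.
have h0' : 2 * a0 - 2 * a1 <= n / a1 - 2 * q.
  rewrite -(ler_pM2r a10) [leRHS]mulrBl divfK ?gt_eqF//; have := sqr_ge0 (a1 - a0); nra.
have H : q - p <= n / a0 / 2 + n / a1 / 2 by lra.
have sa0 : s * (n / a0) <= k * n.
  by rewrite mulrCA mulrC ler_wpM2r// ler_pdivrMr.
have sa1 : s * (n / a1) <= k * n.
  by rewrite mulrCA mulrC ler_wpM2r// ler_pdivrMr.
(* The inner product is n - s (q - p), and s (q - p) is at most the mean of s n / a0 and s n / a1,
   both bounded by k n. Cauchy-Schwarz then turns the inner product into a norm. *)
have key : (1 - k) * n <= edot D (D - s *: (e1 - e0)).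
  rewrite !edotE -/n -/p -/q; nra.
rewrite -(ler_pM2r xp) -mulrA -expr2 sqr_enorm -/n (le_trans key)//.
by rewrite mulrC edot_le.
Qed.

End exterior_ball_geometry.

(** * Measures with a density *)

Section density_measure.
Context {disp} {T : measurableType disp} {R : realType}.
Variable mu : {measure set T -> \bar R}.
Local Open Scope ereal_scope.
Import HBNNSimple.

(** Nonnegativity and measurability of the weight are carried as arguments, so that the measure
    structure can be inferred from the term alone. *)
Definition mdensity (w : T -> R) (w0 : forall x, (0 <= w x)%R)
    (mw : measurable_fun [set: T] w) (A : set T) : \bar R :=
  \int[mu]_(x in A) (w x)%:E.

Variables (w : T -> R) (w0 : forall x, (0 <= w x)%R).
Variable mw : measurable_fun [set: T] w.

Let mdensity0 : mdensity w0 mw set0 = 0.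
Proof. exact: integral_set0. Qed.

Let mdensity_ge0 A : 0 <= mdensity w0 mw A.
Proof. by apply: integral_ge0 => x _; rewrite lee_fin. Qed.

Let mdensity_sigma_additive : semi_sigma_additive (mdensity w0 mw).
Proof.
move=> F mF tF mUF; rewrite /mdensity ge0_integral_bigcup//.
- apply: is_cvg_ereal_nneg_natsum => n _.
  by apply: integral_ge0 => x _; rewrite lee_fin.
- exact/measurable_EFinP/measurable_funTS.
- by move=> x _; rewrite lee_fin.
Qed.

HB.instance Definition _ := isMeasure.Build _ _ _ (mdensity w0 mw)
  mdensity0 mdensity_ge0 mdensity_sigma_additive.

Lemma ge0_integral_mdensity (f : T -> \bar R) : measurable_fun [set: T] f ->
  (forall x, 0 <= f x) ->
  \int[mdensity w0 mw]_x f x = \int[mu]_x (f x * (w x)%:E).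
Proof.
move=> mf f0; pose h := nnsfun_approx measurableT mf.
have mh n : measurable_fun [set: T] (EFin \o h n).
  exact/measurable_EFinP/measurable_funP.
have mwE : measurable_fun [set: T] (EFin \o w) by exact/measurable_EFinP.
have -> : \int[mdensity w0 mw]_x f x =
    limn (fun n => \int[mdensity w0 mw]_x (h n x)%:E).
  rewrite -monotone_convergence//.
  - apply: eq_integral => x _; apply/esym/cvg_lim => //.
    by apply: cvg_nnsfun_approx => // *; exact: f0.
  - by move=> n x _; rewrite lee_fin.
  - by move=> x _ m n mn; rewrite lee_fin; exact/lefP/nd_nnsfun_approx.
have -> : \int[mu]_x (f x * (w x)%:E) =
    limn (fun n => \int[mu]_x ((h n x)%:E * (w x)%:E)).
  rewrite -monotone_convergence//.
  - apply: eq_integral => x _; apply/esym/cvg_lim => //.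
    by apply: cvgeZr => //; apply: cvg_nnsfun_approx => // *; exact: f0.
  - by move=> n; apply: emeasurable_funM; [exact: mh|exact: mwE].
  - by move=> n x _; rewrite mule_ge0// lee_fin.
  - move=> x _ m n mn; rewrite lee_wpmul2r// lee_fin//.
    exact/lefP/nd_nnsfun_approx.
congr (limn _); apply/funext => n.
transitivity (\int[mdensity w0 mw]_x
   (\sum_(y \in range (h n)) (y * \1_(h n @^-1` [set y]) x)%:E)).
  by apply: eq_integral => t tE; rewrite /= fimfunE -fsumEFin.
have indich r : measurable_fun [set: T] (fun x => (r * \1_(h n @^-1` [set r]) x)%:E).
  by apply: (measurable_comp measurableT) => //; exact: measurable_funM.
rewrite ge0_integral_fsum//; last by move=> m y Ey; exact: nnfun_muleindic_ge0.
transitivity (\int[mu]_x (\sum_(y \in range (h n))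
    (y * \1_(h n @^-1` [set y]) x)%:E * (w x)%:E)); last first.
  apply: eq_integral => x _; rewrite -ge0_mule_fsuml => [|y]; last first.
    exact: nnfun_muleindic_ge0.
  by rewrite fsumEFin // -(fimfunE _ x).
rewrite ge0_integral_fsum//; last 2 first.
  - by move=> y; exact: emeasurable_funM.
  - move=> m y Ey; apply: mule_ge0; last by rewrite lee_fin.
    exact: nnfun_muleindic_ge0.
apply: eq_fsbigr => r rhn.
under eq_integral do rewrite EFinM.
rewrite integralZl_indic_nnsfun => //.
under [RHS]eq_integral do rewrite EFinM -muleA.
have mA : measurable (h n @^-1` [set r]) by [].
rewrite ge0_integralZl//.
- under [in RHS]eq_integral do rewrite muleC.
  rewrite [in RHS](eq_integral ((EFin \o w) \_ (h n @^-1` [set r]))); last first.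
    by move=> x xE; rewrite epatch_indic.
  by rewrite -integral_mkcond integral_indic// setIT.
- by apply: emeasurable_funM => //; exact/measurable_EFinP.
- by move=> t Et; rewrite mule_ge0 ?lee_fin.
- by move: rhn; rewrite inE => -[t _ <-]; rewrite lee_fin.
Qed.

End density_measure.

(** * Dyadic approximation of Borel sets *)

Section dyadic.
Context {R : realType} {d : nat}.
Implicit Types (v w : 'rV[R]_d) (A F : set 'rV[R]_d) (k l : nat).

Lemma measurable_rV_box (B : 'I_d -> set R) : (forall i, measurable (B i)) ->
  measurable [set v : 'rV[R]_d | forall i, B i (v ord0 i)].
Proof.
move=> mB; rewrite (_ : mkset _ = \bigcap_(i in [set: 'I_d])
    ((fun v : 'rV[R]_d => v ord0 i) @^-1` B i)).
  apply: fin_bigcap_measurable => // i _.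
  by rewrite -[X in measurable X]setTI; exact: measurable_coord.
by apply/seteqP; split => v H i; [move=> _; exact: H | exact: (H i I)].
Qed.

Lemma exists_exp2V_lt (e : R) : 0 < e -> exists k : nat, 2 ^- k < e.
Proof.
move=> e0; have : (2^-1 : R) ^+ k @[k --> \oo] --> (0 : R).
  by apply: cvg_expr; rewrite ger0_norm ?invr_ge0// invf_lt1// ltr1n.
move=> /cvgr_lt /(_ _ e0)[k _ /(_ k (leqnn k))/=]; exists k.
by rewrite -exprVn.
Qed.

(** Label of the half-open dyadic cube of side 2^-k containing v: the cubes are the fibres of
    [dyad k], and lying in the same cube is an equality. *)
Definition dyad k v : 'rV[int]_d := \row_i Num.floor (2 ^+ k * v ord0 i).

(** The integer m floor(a) lies below m a, hence below floor(m a) = floor(m b) <= m b, so floor(a)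
    <= b. This is what makes dyadic cubes nested. *)
Lemma floor_mul_nat (m : nat) (x y : R) : (0 < m)%N ->
  Num.floor (m%:R * x) = Num.floor (m%:R * y) -> Num.floor x = Num.floor y.
Proof.
move=> m0; suff H (a b : R) : Num.floor (m%:R * a) = Num.floor (m%:R * b) ->
    (Num.floor a <= Num.floor b)%R.
  by move=> xy; apply/eqP; rewrite eq_le H//= H.
move=> ab; rewrite floor_ge_int -(ler_pM2l (_ : 0 < m%:R :> R)) ?ltr0n//.
rewrite (le_trans _ (floor_le (m%:R * b)))// -ab.
have : ((m%:Z * Num.floor a)%:~R : R) <= m%:R * a.
  by rewrite intrM ler_wpM2l// floor_le.
by rewrite -floor_ge_int -(ler_int R) intrM.
Qed.

Lemma dyad_coarser k l v w : (k <= l)%N -> dyad l v = dyad l w ->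
  dyad k v = dyad k w.
Proof.
move=> kl vw; apply/rowP => i; rewrite !mxE.
apply: (@floor_mul_nat (2 ^ (l - k))); first by rewrite expn_gt0.
rewrite natrX !mulrA -exprD subnK//.
by have /rowP/(_ i) := vw; rewrite !mxE.
Qed.

Lemma dyad_dist k v w i : dyad k v = dyad k w ->
  `|v ord0 i - w ord0 i| <= 2 ^- k.
Proof.
move=> /rowP/(_ i); rewrite !mxE => vw.
have k0 : 0 < (2 ^+ k : R) by rewrite exprn_gt0.
rewrite -(ler_pM2l k0) mulfV ?gt_eqF// -[X in X * _](gtr0_norm k0) -normrM.
rewrite mulrBr; set a := 2 ^+ k * v _ _ in vw *; set b := 2 ^+ k * w _ _ in vw *.
have := floor_le a; have := floorD1_gt a; have := floor_le b; have := floorD1_gt b.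
rewrite -vw intrD => *; rewrite ler_norml; lra.
Qed.

Lemma dyad_cellE k (c : 'rV[int]_d) : [set v | dyad k v = c] =
  [set v | forall i, `[(c ord0 i)%:~R / 2 ^+ k, (c ord0 i + 1)%:~R / 2 ^+ k[%classic
                       (v ord0 i)].
Proof.
have k0 : 0 < (2 ^+ k : R) by rewrite exprn_gt0.
apply/seteqP; split => v /=.
  move=> <- i; rewrite in_itv/= ler_pdivrMr// ltr_pdivlMr// !mxE.
  by rewrite (mulrC (v _ _)) floor_le floorD1_gt.
move=> vc; apply/rowP => i; rewrite mxE; apply: floor_def.
by have := vc i; rewrite in_itv/= ler_pdivrMr// ltr_pdivlMr// (mulrC (v _ _)).
Qed.

Lemma measurable_dyad_cell k (c : 'rV[int]_d) : measurable [set v | dyad k v = c].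
Proof.
rewrite dyad_cellE; exact: (measurable_rV_box (fun i => measurable_itv _)).
Qed.

Lemma lebesgue_dyad_cell k (c : 'rV[int]_d) :
  lebesgue_rV R d [set v | dyad k v = c] = ((2 ^- k) ^+ d)%:E.
Proof.
rewrite dyad_cellE (lebesgue_rV_box (fun i => measurable_itv _)).
rewrite (eq_bigr (fun=> (2 ^- k)%:E)); last first.
  move=> i _; rewrite lebesgue_measure_itv/= lte_fin ltr_pM2r ?invr_gt0//.
  by rewrite ltr_int ltrDl/= -EFinD intrD -mulrBl addrC addKr mul1r.
by rewrite prodEFin prodr_const card_ord.
Qed.

(** Unions of cubes of level k, expressed as invariance so that stability under union, complement
    and refinement is immediate. *)
Definition dyad_saturated k F := forall v w, dyad k v = dyad k w -> F v -> F w.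

(** Enumeration of the cubes by natural numbers. [pickle_inv] is defined only on exact codes, so no
    cube is listed twice and the family is disjoint. *)
Let cell k n : set 'rV[R]_d :=
  if @pickle_inv 'rV[int]_d n is Some c then [set v | dyad k v = c] else set0.

Let measurable_cell k n : measurable (cell k n).
Proof. by rewrite /cell; case: pickle_inv => // c; exact: measurable_dyad_cell. Qed.

Let trivIset_cell k : trivIset setT (cell k).
Proof.
move=> i j _ _; rewrite /cell.
case ui : (pickle_inv i) => [a|]; last by move=> [v []].
case uj : (pickle_inv j) => [b|]; last by move=> [v []].
move=> [v [/= va vb]]; rewrite -va in ui; rewrite -vb in uj.
have := @pickle_invK 'rV[int]_d i; have := @pickle_invK 'rV[int]_d j.
by rewrite ui uj/= => <- <-.
Qed.

Let bigcup_cell k : \bigcup_n (cell k n) = setT.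
Proof.
apply/seteqP; split => // v _; exists (pickle (dyad k v)) => //.
by rewrite /cell pickleK_inv.
Qed.

Let saturated_cell k F n : dyad_saturated k F ->
  F `&` cell k n = cell k n \/ F `&` cell k n = set0.
Proof.
move=> sF; have [[v [Fv cv]]|/set0P/negP/negPn/eqP] := pselect (F `&` cell k n !=set0).
  left; apply/seteqP; split => [w []//|w cw]; split => //; move: cv cw.
  by rewrite /cell; case: pickle_inv => //= c <- wv; apply: sF Fv.
by right.
Qed.

Let bigcup_saturated k F : F = \bigcup_n (F `&` cell k n).
Proof. by rewrite -setI_bigcupr bigcup_cell setIT. Qed.

Lemma dyad_saturated_measurable k F : dyad_saturated k F -> measurable F.
Proof.
move=> sF; rewrite (bigcup_saturated k F); apply: bigcupT_measurable => n.
by have [->|->] := saturated_cell n sF.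
Qed.

Lemma dyad_saturatedW k l F : (k <= l)%N -> dyad_saturated k F -> dyad_saturated l F.
Proof. by move=> kl sF v w /(dyad_coarser kl); exact: sF. Qed.

Lemma dyad_saturatedU k F G : dyad_saturated k F -> dyad_saturated k G ->
  dyad_saturated k (F `|` G).
Proof.
by move=> sF sG v w vw [Fv|Gv]; [left; exact: sF Fv|right; exact: sG Gv].
Qed.

Lemma dyad_saturatedC k F : dyad_saturated k F -> dyad_saturated k (~` F).
Proof. by move=> sF v w vw nFv Fw; apply: nFv; exact: sF Fw. Qed.

Local Open Scope ereal_scope.

Lemma le_measure_saturated (m1 m2 : {measure set 'rV[R]_d -> \bar R}) k F :
  (forall c, m1 [set v | dyad k v = c] <= m2 [set v | dyad k v = c]) ->
  dyad_saturated k F -> m1 F <= m2 F.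
Proof.
move=> m12 sF; rewrite (bigcup_saturated k F).
have mFc n : measurable (F `&` cell k n).
  by apply: measurableI => //; exact: dyad_saturated_measurable sF.
have tFc : trivIset setT (fun n => F `&` cell k n).
  by apply: trivIset_setIl; exact: trivIset_cell.
rewrite !measure_bigcup//; apply: lee_nneseries => // n _.
have [->|->] := saturated_cell n sF; last by rewrite !measure0.
by rewrite /cell; case: pickle_inv => //; rewrite !measure0.
Qed.

Section approximation.
Variable m : {measure set 'rV[R]_d -> \bar R}.
Hypothesis moo : m setT < +oo.

Let symdiff A F := (A `\` F) `|` (F `\` A).

(** The sets approximable in m-measure by saturated ones form a sigma-algebra containing the open
    sets, hence all Borel sets. *)
Let approx A := measurable A /\ forall e : R, (0 < e)%R ->
  exists k F, dyad_saturated k F /\ m (symdiff A F) < e%:E.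

Let mfin A : measurable A -> m A < +oo.
Proof. by move=> mA; apply: le_lt_trans moo; rewrite le_measure ?inE. Qed.

Let msd A k F : measurable A -> dyad_saturated k F -> measurable (symdiff A F).
Proof.
move=> mA /dyad_saturated_measurable mF.
by apply: measurableU; apply: measurableD.
Qed.

Let approx_saturated k F : dyad_saturated k F -> approx F.
Proof.
move=> sF; split => [|e e0]; first exact: dyad_saturated_measurable sF.
by exists k, F; split => //; rewrite /symdiff !setDv setU0 measure0 lte_fin.
Qed.

Let approxU A B : approx A -> approx B -> approx (A `|` B).
Proof.
move=> [mA aA] [mB aB]; split => [|e e0]; first exact: measurableU.
have e20 : (0 < e / 2)%R by rewrite divr_gt0.
have [k [F [sF AF]]] := aA _ e20; have [l [G [sG BG]]] := aB _ e20.
exists (maxn k l), (F `|` G); split.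
  by apply: dyad_saturatedU;
    [exact: (dyad_saturatedW (leq_maxl _ _) sF)|
     exact: (dyad_saturatedW (leq_maxr _ _) sG)].
have mAF := msd mA sF; have mBG := msd mB sG.
have mF := dyad_saturated_measurable sF; have mG := dyad_saturated_measurable sG.
apply: (@le_lt_trans _ _ (m (symdiff A F) + m (symdiff B G))).
  apply: le_trans (measureU2 _ mAF mBG).
  rewrite le_measure ?inE//.
  - by apply: measurableU; apply: measurableD; exact: measurableU.
  - exact: measurableU.
  - move=> v [[[Av|Bv] /not_orP[nF nG]]|[[Fv|Gv] /not_orP[nA nB]]].
    + by left; left.
    + by right; left.
    + by left; right.
    + by right; right.
by rewrite [e](splitr e) EFinD; exact: lteD.
Qed.

Let approx_bigcup (A : (set 'rV[R]_d)^nat) : (forall n, approx (A n)) ->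
  approx (\bigcup_n A n).
Proof.
move=> aA; have mA n : measurable (A n) by case: (aA n).
have mUA : measurable (\bigcup_n A n) by exact: bigcupT_measurable.
split => // e e0.
have e20 : (0 < e / 2)%R by rewrite divr_gt0.
pose B n := \big[setU/set0]_(i < n) A i.
have aB n : approx (B n).
  elim: n => [|n IHn]; last by rewrite /B big_ord_recr; exact: approxU.
  rewrite /B big_ord0; exact: (@approx_saturated 0).
have mB n : measurable (B n) by case: (aB n).
(* [C n] is what the first n sets leave out of the union. Its measure tends to 0 by continuity from
   above, where finiteness of m enters; the finite union [B n] is then approximated with the other
   half of e. *)
pose C n := \bigcup_n A n `\` B n.
have mC n : measurable (C n) by exact: measurableD.
have C0 : \bigcap_n C n = set0.
  rewrite -subset0 => v Cv; have [[n _ Anv] _] := Cv 0%N I.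
  have [_] := Cv n.+1 I; apply; rewrite /B big_ord_recr/=; by right.
have : m \o C @ \oo --> m (\bigcap_n C n).
  apply: nonincreasing_cvg_mu => //; first exact: mfin.
    by rewrite C0.
  apply/nonincreasing_seqP => n; apply/subsetPset => v [UA nB]; split => //.
  by move=> Bv; apply: nB; rewrite /B big_ord_recr/=; left.
rewrite C0 measure0 => /fine_cvgP[_] /cvgr_lt /(_ _ e20)[N _ /(_ N (leqnn N))/=].
move=> CN; have [k [F [sF BF]]] := (aB N).2 _ e20.
exists k, F; split => //; have mBF := msd (mB N) sF.
have mF := dyad_saturated_measurable sF.
apply: (@le_lt_trans _ _ (m (C N) + m (symdiff (B N) F))).
  apply: le_trans (measureU2 _ (mC N) mBF).
  rewrite le_measure ?inE//.
  - by apply: measurableU; apply: measurableD.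
  - exact: measurableU.
  - move=> v [[UA nF]|[Fv nUA]].
      by have [Bv|nB] := pselect (B N v); [right; left|left].
    right; right; split => // Bv; apply: nUA; move: Bv.
    by rewrite /B -bigcup_mkord => -[i _ ?]; exists i.
rewrite [e](splitr e) EFinD; apply: lteD => //.
by rewrite -[X in X < _]fineK ?lte_fin// ge0_fin_numE// mfin.
Qed.

Lemma dyad_approximation A : measurable A -> forall e : R, (0 < e)%R ->
  exists k F, dyad_saturated k F /\
    m ((A `\` F) `|` (F `\` A)) < e%:E.
Proof.
suff : measurable `<=` approx by move=> + mA e e0 => /(_ _ mA)[_]; exact.
rewrite rV_measurableE; apply: smallest_sub.
  split.
  - exact: (@approx_saturated 0).
  - move=> B [mB aB]; rewrite setTD; split => [|e e0]; first exact: measurableC.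
    have [k [F [sF BF]]] := aB _ e0; exists k, (~` F).
    split; first exact: dyad_saturatedC.
    rewrite (_ : symdiff _ _ = symdiff B F)//; apply/seteqP.
    rewrite /symdiff !setDE !setCK.
    by split => v [[? ?]|[? ?]]; [right|left|right|left].
  - exact: approx_bigcup.
(* [F k] collects the points whose cube of level k is contained in U. It is saturated by
   construction, and these sets exhaust U because the diameters of the cubes tend to 0. *)
move=> U oU; pose F k : set 'rV[R]_d := [set v | forall w, dyad k v = dyad k w -> U w].
have -> : U = \bigcup_k F k.
  apply/seteqP; split => v; last by move=> [k _ Fv]; exact: Fv.
  move=> Uv; have /nbhs_ballP[e /= e0 eU] : nbhs v U by exact: open_nbhs_nbhs.
  have [k ke] := exists_exp2V_lt e0.
  exists k => // w vw; apply: eU; split => // i j; rewrite ord1.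
  by rewrite /ball/=; apply: le_lt_trans ke; exact: dyad_dist.
apply: approx_bigcup => k; apply: (@approx_saturated k) => v w vw Fv u wu.
by apply: Fv; rewrite vw.
Qed.

End approximation.

(** The inequality passes to saturated sets by countable additivity, then to Borel sets with an
    error at most e/2 for each of the two measures. *)
Lemma le_measure_dyad (m1 m2 : {measure set 'rV[R]_d -> \bar R}) :
  m1 setT < +oo -> m2 setT < +oo ->
  (forall k c, m1 [set v | dyad k v = c] <= m2 [set v | dyad k v = c]) ->
  forall A, measurable A -> m1 A <= m2 A.
Proof.
move=> m1oo m2oo m12 A mA; apply/lee_addgt0Pr => e e0.
(* Approximating with respect to the sum yields a single saturated set that is close to A for both
   measures. *)
pose m : {measure set 'rV[R]_d -> \bar R} := measure_add m1 m2.
have mE B : m B = m1 B + m2 B by exact: measure_addE.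
have moo : m setT < +oo by rewrite mE lte_add_pinfty.
have e20 : (0 < e / 2)%R by rewrite divr_gt0.
have [k [F [sF AF]]] := dyad_approximation moo mA e20.
have mF := dyad_saturated_measurable sF.
have mD1 : measurable (A `\` F) by exact: measurableD.
have mD2 : measurable (F `\` A) by exact: measurableD.
have {}AF : m1 (A `\` F) < (e / 2)%:E /\ m2 (F `\` A) < (e / 2)%:E.
  split; apply: le_lt_trans AF; rewrite mE.
    apply: (@le_trans _ _ (m1 ((A `\` F) `|` (F `\` A)))); last by rewrite leeDl.
    by rewrite le_measure ?inE//; exact: measurableU.
  apply: (@le_trans _ _ (m2 ((A `\` F) `|` (F `\` A)))); last by rewrite leeDr.
  by rewrite le_measure ?inE//; exact: measurableU.
have h1 : m1 A <= m1 F + m1 (A `\` F).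
  apply: le_trans (measureU2 _ mF mD1); rewrite le_measure ?inE//.
    exact: measurableU.
  by move=> v Av; have [?|?] := pselect (F v); [left|right].
have h2 : m2 F <= m2 A + m2 (F `\` A).
  apply: le_trans (measureU2 _ mA mD2); rewrite le_measure ?inE//.
    exact: measurableU.
  by move=> v Av; have [?|?] := pselect (A v); [left|right].
have h3 := le_measure_saturated (m12 k) sF.
rewrite [e](splitr e) EFinD addeA (le_trans h1)// leeD//; last exact: ltW AF.1.
by rewrite (le_trans h3)// (le_trans h2)// leeD// ltW// AF.2.
Qed.

End dyadic.

Section enorm_measurable.
Context {R : realType} {d : nat}.

Lemma measurable_enorm : measurable_fun [set: 'rV[R]_d] (@enorm R d).
Proof.
apply: (@measurableT_comp _ _ _ _ _ _ (@Num.sqrt R)).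
  by apply: continuous_measurable_fun; exact: sqrt_continuous.
apply: measurable_sum => i; apply: measurable_funX; exact: measurable_coord.
Qed.

Lemma measurable_fun_rV_sub (dt : measure_display) (T : measurableType dt)
    (f g : T -> 'rV[R]_d) : measurable_fun [set: T] f ->
  measurable_fun [set: T] g -> measurable_fun [set: T] (fun x => f x - g x).
Proof.
move=> mf mg; apply: measurable_fun_rV => i; under eq_fun do rewrite !mxE.
by apply: measurable_funB; exact: (measurableT_comp (measurable_coord i)).
Qed.

Lemma measurable_fun_rV_scale (dt : measure_display) (T : measurableType dt)
    (a : T -> R) (f : T -> 'rV[R]_d) : measurable_fun [set: T] a ->
  measurable_fun [set: T] f -> measurable_fun [set: T] (fun x => a x *: f x).
Proof.
move=> ma mf; apply: measurable_fun_rV => i; under eq_fun do rewrite !mxE.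
by apply: measurable_funM => //; exact: (measurableT_comp (measurable_coord i)).
Qed.

End enorm_measurable.

(** * Diameter and enclosing cube of a bounded set *)

Section bounded.
Context {R : realType} {d : nat}.
Variable Omega : set 'rV[R]_d.
Hypothesis bO : bounded_set Omega.

Lemma bounded_set_coord : exists N : nat, forall x i, Omega x -> `|x ord0 i| < N%:R.
Proof.
have [M HM] : exists M : R, forall x, Omega x -> `|x| <= M.
  by have [M [_ MO]] := bO; exists (M + 1) => x; apply: MO; rewrite ltrDl.
exists (Num.truncn M).+1 => x i Ox; apply: le_lt_trans (truncnS_gt M).
apply: le_trans (HM _ Ox); rewrite /Num.norm/= mx_normrE.
by apply: (le_bigmax _ (fun ij => `|x ij.1 ij.2|) (ord0, i)).
Qed.

(** The closure is needed because projections lie on the boundary, outside the open set whose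
    diameter is taken. *)
Lemma closure_ediam x y : closure Omega x -> closure Omega y ->
  enorm (x - y) <= ediam Omega.
Proof.
have [N HN] := bounded_set_coord.
have ub a b : Omega a -> Omega b -> enorm (a - b) <= ediam Omega.
  move=> Oa Ob; apply: ub_le_sup; last by exists a => //; exists b.
  exists (d%:R * (N%:R + N%:R)) => _ [u Ou [v Ov <-]].
  apply: ler_enorm_coord => [|i]; first by rewrite addr_ge0.
  by rewrite !mxE (le_trans (ler_normB _ _))// lerD// ltW// HN.
move=> cx cy; apply/ler_addgt0Pr => e e0.
have e20 : 0 < e / 2 by rewrite divr_gt0.
have [a [Oa /= xa]] := cx _ (ltr_enorm_nbhs x e20).
have [b [Ob /= yb]] := cy _ (ltr_enorm_nbhs y e20).
have := ler_enorm_dist x a y; have := ler_enorm_dist a b y; have := ub a b Oa Ob.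
rewrite (enorm_distC x a) => h1 h2 h3; lra.
Qed.

(** A cube with integer corners cuts no dyadic cube of level 0 or finer. Restricting Lebesgue
    measure to it gives a finite measure that still agrees with Lebesgue measure on every dyadic
    cube meeting it. *)
Lemma dyad_saturated_cover : exists B : set 'rV[R]_d,
  [/\ dyad_saturated 0 B, Omega `<=` B & (lebesgue_rV R d B < +oo)%E].
Proof.
have [N HN] := bounded_set_coord.
exists [set v | forall i, `[- N%:R, N%:R[%classic (v ord0 i)]; split.
- move=> v w /rowP vw vB i; have := vB i; have := vw i; rewrite /= !in_itv/= !mxE.
  rewrite expr0 !mul1r => vwi /andP[v1 v2].
  have zN (u : R) : (- N%:R <= u) = (- N%:Z <= Num.floor u)%R.
    by rewrite floor_ge_int intrN -pmulrn.
  have zN' (u : R) : (u < N%:R) = (Num.floor u < N%:Z)%R.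
    by rewrite floor_lt_int -pmulrn.
  by rewrite zN zN' -vwi -zN -zN' v1.
- move=> v Ov i /=; rewrite in_itv/=.
  by have := HN _ i Ov; rewrite ltr_norml => /andP[/ltW -> ->].
- rewrite (lebesgue_rV_box (fun i => measurable_itv _)).
  rewrite (eq_bigr (fun=> (if (- N%:R < N%:R :> R) then N%:R + N%:R else 0)%:E)).
    by rewrite prodEFin ltry.
  by move=> i _; rewrite lebesgue_measure_itv/= lte_fin opprK; case: ifPn.
Qed.

Lemma bounded_lebesgue_lty : measurable Omega -> (lebesgue_rV R d Omega < +oo)%E.
Proof.
move=> mO; have [B [sB OB]] := dyad_saturated_cover; apply: le_lt_trans.
by rewrite le_measure ?inE//; exact: dyad_saturated_measurable sB.
Qed.

End bounded.

(** * Transport rays *)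

Section rays.
Context {R : realType} {d : nat}.
Variables (Omega : set 'rV[R]_d) (r : R) (P : 'rV[R]_d -> 'rV[R]_d).
Hypotheses (oO : open Omega) (bO : bounded_set Omega) (r0 : 0 < r).
Hypothesis extO : uniform_exterior_ball Omega r.
Hypothesis projP : borel_projection_selector Omega P.
Implicit Types (x y : 'rV[R]_d) (s : R).

(* With this extension bdist vanishes outside Omega, so that s < bdist x with
   s >= 0 forces x into Omega. *)
Definition proj_ext x := if x \in Omega then P x else x.

Definition bdist x := enorm (x - proj_ext x).

(** The map S_s of the overview. Off Omega the direction vanishes, so the map is the identity
    there. *)
Definition ray s x := x + (s * (bdist x)^-1) *: (proj_ext x - x).

Lemma proj_extE x : Omega x -> proj_ext x = P x.
Proof. by move=> Ox; rewrite /proj_ext mem_set. Qed.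

Lemma bdistE x : Omega x -> bdist x = enorm (x - P x).
Proof. by move=> Ox; rewrite /bdist proj_extE. Qed.

Lemma bdist_ge0 x : 0 <= bdist x. Proof. exact: enorm_ge0. Qed.

Lemma bdist_out x : ~ Omega x -> bdist x = 0.
Proof. by move=> nOx; rewrite /bdist /proj_ext memNset// subrr enorm0. Qed.

Lemma bdist_gt0 x : Omega x -> 0 < bdist x.
Proof.
move=> Ox; rewrite lt_def bdist_ge0 andbT; apply/eqP; rewrite bdistE// => /enorm_eq0.
move=> /eqP; rewrite subr_eq0 => /eqP xP; have [[_ nP] _] := projP.2 _ Ox.
by apply: nP; rewrite -xP; exact: open_nbhs_nbhs.
Qed.

Lemma lt_bdist_in s x : 0 <= s -> s < bdist x -> Omega x.
Proof.
move=> s0 sx; apply: contrapT => nOx; move: sx; rewrite bdist_out// ltNge.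
by rewrite s0.
Qed.

Lemma eball_bdist x : Omega x -> eball x (bdist x) `<=` Omega.
Proof.
by move=> Ox; apply: eball_sub_open => // y; rewrite bdistE//; exact: (projP.2 _ Ox).2.
Qed.

Lemma bdist_le_ediam_in x : Omega x -> bdist x <= ediam Omega.
Proof.
move=> Ox; rewrite bdistE//; apply: closure_ediam => //; first exact: subset_closure.
by case: (projP.2 _ Ox) => -[].
Qed.

Lemma enorm_ray s x : 0 <= s -> s < bdist x -> enorm (ray s x - x) = s.
Proof.
move=> s0 sx; have b0 : 0 < bdist x by exact: le_lt_trans sx.
rewrite /ray addrAC subrr add0r enormZ enorm_distC -/(bdist x).
by rewrite ger0_norm ?divfK ?gt_eqF// divr_ge0// ltW.
Qed.

Lemma ray_in s x : 0 <= s -> s < bdist x -> Omega (ray s x).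
Proof.
move=> s0 sx; apply: (eball_bdist (lt_bdist_in s0 sx)).
by rewrite /eball/= enorm_ray.
Qed.

(** The gap is stated for every y of Omega, not only for x: the comparison of two rays evaluates the
    center of each at the starting point of the other. *)
Lemma ray_exterior_center x : Omega x -> exists c,
  x - c = ((bdist x + r) / bdist x) *: (x - P x) /\
  forall y, Omega y -> bdist y + r <= enorm (y - c).
Proof.
move=> Ox; have [c [cO cP]] := extO (projP.2 _ Ox).1.
have gap y : Omega y -> bdist y + r <= enorm (y - c).
  by move=> Oy; apply: (disjoint_eball_dist (bdist_gt0 Oy)) cO => //; exact: eball_bdist.
exists c; split => //; rewrite bdistE//.
apply: collinear_of_dist => //; [by rewrite -bdistE// bdist_gt0|exact: ltW|].
by rewrite -bdistE//; exact: gap.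
Qed.

(** Instance of [ray_expansion] with radii bdist + r and k = D / (D + r), so that 1 - k = r / (r +
    D). Backwards in time the ray map is Lipschitz with constant (r + D) / r, uniformly in s. *)
Lemma ray_contraction s x y : 0 <= s -> s < bdist x -> s < bdist y ->
  r / (r + ediam Omega) * enorm (y - x) <= enorm (ray s y - ray s x).
Proof.
move=> s0 sx sy; have Ox := lt_bdist_in s0 sx; have Oy := lt_bdist_in s0 sy.
have [c [xc gapc]] := ray_exterior_center Ox.
have [e [ye gape]] := ray_exterior_center Oy.
have bx := bdist_gt0 Ox; have by_ := bdist_gt0 Oy.
have Dx := bdist_le_ediam_in Ox; have Dy := bdist_le_ediam_in Oy.
set D := ediam Omega in Dx Dy *.
pose u z := (bdist z)^-1 *: (z - P z).
have u1 z : Omega z -> enorm (u z) = 1.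
  move=> Oz; have bz := bdist_gt0 Oz; rewrite enormZ -bdistE// ger0_norm ?invr_ge0 ?ltW//.
  by rewrite mulVf ?gt_eqF.
have rayE z : Omega z -> ray s z = z - s *: u z.
  move=> Oz; rewrite /ray proj_extE//; apply/rowP => i; rewrite !mxE.
  by set b := (_)^-1; ring.
rewrite (rayE _ Ox) (rayE _ Oy).
have D0 : 0 < D by exact: lt_le_trans Dx.
have Dr : 0 < D + r by rewrite addr_gt0.
have -> : r / (r + D) = 1 - D / (D + r) by field; lra.
(* Since s < bdist z, it is enough that t / (t + r) increases with t and that bdist z <= D. *)
have sD z : s < bdist z -> bdist z <= D -> s <= D / (D + r) * (bdist z + r).
  move=> sz zD; rewrite mulrAC ler_pdivlMr//.
  have h1 : s * D <= bdist z * D by rewrite ler_wpM2r// ltW.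
  have h2 : s * r <= D * r by rewrite ler_wpM2r// ltW// (lt_le_trans sz).
  lra.
have centerE z w : Omega z -> z - w = ((bdist z + r) / bdist z) *: (z - P z) ->
    z - (bdist z + r) *: u z = w.
  move=> Oz zw; rewrite /u scalerA -zw; apply/rowP => i; rewrite !mxE; ring.
apply: (@ray_expansion _ _ _ _ _ _ (bdist x + r) (bdist y + r)) => //.
- by rewrite addr_gt0.
- by rewrite addr_gt0.
- exact: sD.
- exact: sD.
- exact: u1.
- exact: u1.
- by rewrite (centerE _ _ Ox xc); exact: gapc.
- by rewrite (centerE _ _ Oy ye); exact: gape.
Qed.

End rays.

(** * Image measures along the rays *)

Section ray_measure.
Context {R : realType} {d : nat}.
Variables (Omega : set 'rV[R]_d) (P : 'rV[R]_d -> 'rV[R]_d).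
Hypothesis oO : open Omega.
Hypothesis projP : borel_projection_selector Omega P.
Implicit Types (x y : 'rV[R]_d) (s : R).

Local Notation bdist := (bdist Omega P).
Local Notation ray := (ray Omega P).
Local Notation leb := (@lebesgue_measure R).
Local Notation lam := (lebesgue_rV R d).

Let mO : measurable Omega. Proof. exact: measurable_rV_open. Qed.

Lemma measurable_proj_ext : measurable_fun [set: 'rV[R]_d] (proj_ext Omega P).
Proof.
apply: measurable_fun_rV => i.
rewrite (_ : (fun x => _) = (((fun x => P x ord0 i) \_ Omega) \+
    ((fun x : 'rV[R]_d => x ord0 i) \_ (~` Omega)))%R).
  apply: measurable_funD.
    apply/(measurable_restrictT _ mO).
    exact: (measurableT_comp (measurable_coord i) projP.1).
  apply/(measurable_restrictT _ (measurableC mO)).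
  by apply: measurable_funTS; exact: measurable_coord.
apply/funext => x /=; rewrite !patchE in_setC /proj_ext.
by case: ifPn => _ /=; rewrite ?addr0 ?add0r.
Qed.

Lemma measurable_bdist : measurable_fun [set: 'rV[R]_d] bdist.
Proof.
apply: (measurableT_comp measurable_enorm).
by apply: measurable_fun_rV_sub => //; exact: measurable_proj_ext.
Qed.

Let measurable_ray_R :
  measurable_fun [set: R * 'rV[R]_d] (fun z => ray z.1 z.2).
Proof.
(* The inverse is written as a real power to use [measurable_powR]; the two agree on nonnegative
   numbers, including 0. *)
pose f (z : R * 'rV[R]_d) : 'rV[R]_d :=
  (z.1 * bdist z.2 `^ (-1)) *: (proj_ext Omega P z.2 - z.2).
rewrite (_ : (fun z => _) = fun z => z.2 - ((-1)%R *: f z)).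
  have mp : measurable_fun [set: R * 'rV[R]_d] (proj_ext Omega P \o snd).
    by apply: measurableT_comp => //; exact: measurable_proj_ext.
  apply: measurable_fun_rV_sub; first exact: measurable_snd.
  apply: measurable_fun_rV_scale => //; apply: measurable_fun_rV_scale.
    apply: measurable_funM; first exact: measurable_fst.
    apply: (measurableT_comp (measurable_powR (-1))).
    by apply: measurableT_comp => //; exact: measurable_bdist.
  by apply: measurable_fun_rV_sub.
by apply/funext => z; rewrite scaleN1r opprK /f powR_inv1 ?bdist_ge0.
Qed.

Lemma measurable_ray :
  measurable_fun [set: measurableTypeR R * 'rV[R]_d] (fun z => ray z.1 z.2).
Proof. exact: measurable_ray_R. Qed.

Definition raydom : set (R * 'rV[R]_d) := [set z | (0 <= z.1) && (z.1 < bdist z.2)].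

Let measurable_raydom_R : measurable raydom.
Proof.
rewrite -[raydom]setTI; pose b (z : R * 'rV[R]_d) := (0 <= z.1) && (z.1 < bdist z.2).
have mb : measurable_fun [set: R * 'rV[R]_d] b.
  apply: measurable_and.
    by apply: measurable_fun_ler => //; exact: measurable_fst.
  apply: measurable_fun_ltr; first exact: measurable_fst.
  by apply: measurableT_comp => //; exact: measurable_bdist.
exact: (mb measurableT [set true]).
Qed.

Lemma measurable_raydom : @measurable _ (measurableTypeR R * 'rV[R]_d)%type raydom.
Proof. exact: measurable_raydom_R. Qed.

Local Open Scope ereal_scope.

(** The domain of the rays is put into the weight, so that every integral along rays runs over the
    whole product space. *)
Definition ray_weight (g : 'rV[R]_d -> R) (z : R * 'rV[R]_d) : R :=
  g z.2 * \1_raydom z.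

Lemma measurable_ray_weight (g : 'rV[R]_d -> R) : measurable_fun [set: 'rV[R]_d] g ->
  measurable_fun [set: measurableTypeR R * 'rV[R]_d] (ray_weight g).
Proof.
move=> mg; apply: measurable_funM.
  by apply: measurableT_comp => //; exact: measurable_snd.
by apply: measurable_indic; exact: measurable_raydom.
Qed.

Lemma ray_weight_ge0 (g : 'rV[R]_d -> R) : (forall x, 0 <= g x)%R ->
  forall z, (0 <= ray_weight g z)%R.
Proof. by move=> g0 z; rewrite mulr_ge0. Qed.

(** The measure is the image under [ray] of the product measure weighted by [ray_weight g]. Only its
    integrals matter later, so the construction stays behind the existential. *)
Lemma ray_measure_exists (g : 'rV[R]_d -> R) : (forall x, 0 <= g x)%R ->
  measurable_fun [set: 'rV[R]_d] g ->
  exists m : {measure set 'rV[R]_d -> \bar R},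
  forall phi : 'rV[R]_d -> \bar R, measurable_fun [set: 'rV[R]_d] phi -> (forall y, 0 <= phi y) ->
    \int[m]_y phi y = \int[leb \x lam]_z (phi (ray z.1 z.2) * (ray_weight g z)%:E).
Proof.
move=> g0 mg.
pose m0 := [the measure _ _ of
  mdensity (leb \x lam) (ray_weight_ge0 g0) (measurable_ray_weight mg)].
exists (measure_function_pushforward__canonical__measure_function_Measure m0
  measurable_ray).
move=> phi mphi phi0.
rewrite (ge0_integral_pushforward measurable_ray m0)//.
rewrite preimage_setT ge0_integral_mdensity//.
  by apply: measurableT_comp => //; exact: measurable_ray.
by move=> z; exact: phi0.
Qed.

Section inner_integral.
Variables (g : 'rV[R]_d -> R) (phi : 'rV[R]_d -> \bar R).
Hypotheses (g0 : forall x, (0 <= g x)%R) (mg : measurable_fun [set: 'rV[R]_d] g).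
Hypotheses (mphi : measurable_fun [set: 'rV[R]_d] phi) (phi0 : forall y, 0 <= phi y).

Let mf : measurable_fun [set: measurableTypeR R * 'rV[R]_d]
  (fun z => phi (ray z.1 z.2) * (ray_weight g z)%:E).
Proof.
apply: emeasurable_funM; first by apply: measurableT_comp => //; exact: measurable_ray.
by apply/measurable_EFinP; exact: measurable_ray_weight.
Qed.

Let f0 z : 0 <= phi (ray z.1 z.2) * (ray_weight g z)%:E.
Proof. by rewrite mule_ge0// lee_fin ray_weight_ge0. Qed.

Lemma ray_inner_integral x :
  \int[leb]_s (phi (ray s x) * (ray_weight g (s, x))%:E) =
  (g x)%:E * \int[leb]_(s in `[0%R, bdist x[) phi (ray s x).
Proof.
have mphix : measurable_fun [set: measurableTypeR R] (fun s => phi (ray s x)).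
  apply: measurableT_comp => //.
  exact: (measurable_fun_pair1 x measurable_ray).
rewrite [in RHS]integral_mkcond -ge0_integralZl//; last 3 first.
- apply/(measurable_restrictT _ (measurable_itv _)); exact: measurable_funTS mphix.
- by move=> s _; rewrite patchE; case: ifPn.
- by rewrite lee_fin.
apply: eq_integral => s _; rewrite patchE /ray_weight indicE/=.
rewrite (_ : (s, x) \in raydom = (s \in `[0%R, bdist x[%classic)); last first.
  by apply/idP/idP => /set_mem h; apply/mem_set; move: h; rewrite /raydom/= in_itv.
by case: ifPn => _; rewrite ?mulr1 ?mulr0 ?mule0// muleC.
Qed.

Lemma ray_integralE :
  \int[leb \x lam]_z (phi (ray z.1 z.2) * (ray_weight g z)%:E) =
  \int[lam]_x ((g x)%:E * \int[leb]_(s in `[0%R, bdist x[) phi (ray s x)).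
Proof.
rewrite fubini_tonelli2//; apply: eq_integral => x _.
exact: ray_inner_integral.
Qed.

Lemma measurable_ray_inner :
  measurable_fun [set: 'rV[R]_d]
    (fun x => (g x)%:E * \int[leb]_(s in `[0%R, bdist x[) phi (ray s x)).
Proof.
under eq_fun do rewrite -ray_inner_integral.
exact: (measurable_fun_fubini_tonelli_G (m1 := leb) _ mf f0).
Qed.

End inner_integral.

End ray_measure.

(** * Domination of the ray measure by Lebesgue measure *)

Section ray_bound.
Context {R : realType} {d : nat}.
Variables (Omega : set 'rV[R]_d) (r : R) (P : 'rV[R]_d -> 'rV[R]_d).
Hypotheses (oO : open Omega) (bO : bounded_set Omega) (r0 : 0 < r).
Hypothesis O0 : Omega !=set0.
Hypothesis extO : uniform_exterior_ball Omega r.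
Hypothesis projP : borel_projection_selector Omega P.
Implicit Types (x y : 'rV[R]_d) (s : R).

Local Notation bdist := (bdist Omega P).
Local Notation ray := (ray Omega P).
Local Notation raydom := (raydom Omega P).
Local Notation leb := (@lebesgue_measure R).
Local Notation lam := (lebesgue_rV R d).

Let D := ediam Omega.

Lemma bdist_le_ediam x : bdist x <= D.
Proof.
have [y Oy] := O0; have [Ox|nOx] := pselect (Omega x); last first.
  rewrite bdist_out// -(enorm0 (R := R) (d := d)) -(subrr y).
  by apply: closure_ediam => //; exact: subset_closure.
by apply: (bdist_le_ediam_in bO projP).
Qed.

Lemma ediam_gt0 : 0 < D.
Proof.
have [y Oy] := O0; exact: lt_le_trans (bdist_gt0 oO projP Oy) (bdist_le_ediam y).
Qed.

(** Two points of a cube of side l are within d l of each other, so their origins at a common time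
    are within d l (r + D) / r. The origins thus lie in a box of twice that side, whose volume
    relative to l^d is this constant; [ray_const] adds the factor D for the range of s. *)
Definition ray_section_const : R := (2 * (d%:R * ((r + D) / r))) ^+ d.

Definition ray_const : R := D * ray_section_const.

Lemma ray_section_const_ge0 : 0 <= ray_section_const.
Proof.
rewrite exprn_ge0// mulr_ge0// mulr_ge0// divr_ge0 ?addr_ge0// ltW//.
exact: ediam_gt0.
Qed.

Lemma ray_const_ge0 : 0 <= ray_const.
Proof. by rewrite mulr_ge0 ?ray_section_const_ge0// ltW// ediam_gt0. Qed.

Let W (A : set 'rV[R]_d) : set (measurableTypeR R * 'rV[R]_d) :=
  raydom `&` [set z | A (ray z.1 z.2)].

Let measurable_W A : measurable A -> measurable (W A).
Proof.
move=> mA; apply: measurableI; first exact: (measurable_raydom oO projP).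
rewrite -[X in measurable X]setTI; exact: (measurable_ray oO projP).
Qed.

Lemma ray_section_subset s k (c : 'rV[int]_d) x0 :
  W [set v | dyad k v = c] (s, x0) ->
  xsection (W [set v | dyad k v = c]) s `<=`
  [set x | forall i, `[x0 ord0 i - d%:R * ((r + D) / r) * 2 ^- k,
                       x0 ord0 i + d%:R * ((r + D) / r) * 2 ^- k]%classic (x ord0 i)].
Proof.
move=> [/andP[/= s0 sx0] cx0] x; rewrite /xsection/= inE => -[/andP[/= _ sx] cx] i.
have := ray_contraction oO bO r0 extO projP s0 sx0 sx; rewrite -/D => h.
have : enorm (ray s x - ray s x0) <= d%:R * 2 ^- k.
  apply: ler_enorm_coord => [|j]; first by rewrite invr_ge0 exprn_ge0.
  have -> : (ray s x - ray s x0) ord0 j = ray s x ord0 j - ray s x0 ord0 j.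
    by rewrite [LHS]mxE [X in _ + X]mxE.
  by apply: dyad_dist; rewrite cx cx0.
move=> /(le_trans h); have D0 := ediam_gt0.
have rD : 0 < r / (r + D) by rewrite divr_gt0// addr_gt0.
rewrite mulrC -ler_pdivlMr// invf_div => h2.
have := le_trans (ler_coord_enorm (x - x0) i) h2.
rewrite mulrAC !mxE ler_norml => /andP[h3 h4].
by rewrite /= in_itv/=; apply/andP; split; lra.
Qed.

Local Open Scope ereal_scope.

Lemma ray_section_measure s k (c : 'rV[int]_d) :
  lam (xsection (W [set v | dyad k v = c]) s) <=
  (ray_section_const * (2 ^- k) ^+ d)%:E.
Proof.
have mW := measurable_W (measurable_dyad_cell k c).
have [[x0 Wx0]|nW] := pselect (exists x0, W [set v | dyad k v = c] (s, x0)); last first.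
  rewrite (_ : xsection _ _ = set0) ?measure0 ?lee_fin.
    by rewrite mulr_ge0 ?ray_section_const_ge0// exprn_ge0// invr_ge0 exprn_ge0.
  by rewrite -subset0 => x; rewrite /xsection/= inE => Wx; apply: nW; exists x.
have k0 : (0 <= d%:R * ((r + D) / r) * 2 ^- k :> R)%R.
  by rewrite !mulr_ge0// ?invr_ge0 ?exprn_ge0// ?addr_ge0 ?(ltW ediam_gt0)// ltW.
apply: (@le_trans _ _ (lam [set x | forall i,
    `[x0 ord0 i - d%:R * ((r + D) / r) * 2 ^- k,
      x0 ord0 i + d%:R * ((r + D) / r) * 2 ^- k]%classic%R (x ord0 i)])).
  rewrite le_measure ?inE//.
  - exact: measurable_xsection.
  - exact: (measurable_rV_box (fun i => measurable_itv _)).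
  - exact: ray_section_subset.
rewrite (lebesgue_rV_box (fun i => measurable_itv _)).
rewrite (eq_bigr (fun=> (2 * (d%:R * ((r + D) / r)) * 2 ^- k)%:E)); last first.
  move=> i _; rewrite lebesgue_measure_itv/= lte_fin.
  move: k0; set q := (_ * 2 ^- k)%R => q0.
  (* The length of a closed interval is computed by cases on its endpoints; the degenerate case
     forces q = 0, where both sides vanish. *)
  rewrite -EFinD -mulrA -/q; case: ltP => [_|h]; congr EFin; first by ring.
  have : q = 0%R by lra.
  by move=> ->; rewrite mulr0.
by rewrite prodEFin prodr_const card_ord exprMn.
Qed.

Lemma ray_cell_measure k (c : 'rV[int]_d) :
  (leb \x lam) (W [set v | dyad k v = c]) <=
  ray_const%:E * lam [set v | dyad k v = c].
Proof.
have mW := measurable_W (measurable_dyad_cell k c).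
rewrite lebesgue_dyad_cell -EFinM -mulrA.
set q := (_ * _ ^+ d)%R.
have q0 : (0 <= q)%R.
  by rewrite mulr_ge0 ?ray_section_const_ge0// exprn_ge0// invr_ge0 exprn_ge0.
apply: (@le_trans _ _ (\int[leb]_(s in `[0%R, D]) q%:E)); last first.
  rewrite integral_cst//= lebesgue_measure_itv/= lte_fin ediam_gt0.
  by rewrite -EFinD subr0 -EFinM mulrC.
rewrite integral_mkcond; apply: ge0_le_integral => //.
- exact: measurable_fun_xsection.
- by apply/(measurable_restrictT _ (measurable_itv _)); exact: measurable_cst.
- move=> s _; rewrite patchE; case: ifPn => [_|]; first exact: ray_section_measure.
  move=> /negP; rewrite inE/= in_itv/= => sD.
  rewrite (_ : xsection _ _ = set0) ?measure0//.
  rewrite -subset0 => x; rewrite /xsection/= inE => -[/andP[/= s0 sx] _].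
  by apply: sD; rewrite s0 (le_trans (ltW sx))// bdist_le_ediam.
Qed.

(** Stated for functions because the L^p estimate applies it to a truncated power of the density. *)
Lemma ray_integral_le (phi : 'rV[R]_d -> \bar R) :
  measurable_fun [set: 'rV[R]_d] phi -> (forall y, 0 <= phi y) ->
  \int[leb \x lam]_z (phi (ray z.1 z.2) * (ray_weight Omega P (cst 1%R) z)%:E) <=
  ray_const%:E * \int[lam]_y phi y.
Proof.
move=> mphi phi0.
have [m mE] := ray_measure_exists oO projP (g := cst 1%R) (fun=> ler01)
  (measurable_cst _).
rewrite -mE//.
have mWE A : measurable A -> m A = (leb \x lam) (W A).
  move=> mA; have -> : m A = \int[m]_y (\1_A y)%:E by rewrite integral_indic// setIT.
  rewrite mE; last 2 first.
  - by apply/measurable_EFinP; exact: measurable_indic.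
  - by move=> y; rewrite lee_fin.
  transitivity (\int[leb \x lam]_z (\1_(W A) z)%:E).
    apply: eq_integral => z _; rewrite -EFinM; congr EFin.
    by rewrite /ray_weight mul1r /W indicI mulrC.
  by rewrite integral_indic ?setIT//; exact: measurable_W.
have [B [sB OB Boo]] := dyad_saturated_cover bO.
have mB := dyad_saturated_measurable sB.
have Cge0 := ray_const_ge0.
(* Lebesgue measure is cut down to the saturated cube B around Omega in order to be finite, as the
   comparison on dyadic cubes requires. *)
pose m2 : {measure set 'rV[R]_d -> \bar R} := mscale (NngNum Cge0) (mrestr lam mB).
have m2E A : m2 A = ray_const%:E * lam (A `&` B) by [].
have mD : @measurable _ (measurableTypeR R) `[0%R, D]%classic by exact: measurable_itv.
have mle : forall A, measurable A -> m A <= m2 A.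
  apply: le_measure_dyad.
  - rewrite mWE//; apply: (@le_lt_trans _ _ ((leb \x lam) (`[0%R, D]%classic `*` B))).
      rewrite le_measure ?inE//.
      - exact: measurable_W.
      - exact: measurableX.
      - move=> [s x] [/andP[/= s0 sx] _]; split => /=.
          by rewrite in_itv/= s0 (le_trans (ltW sx))// bdist_le_ediam.
        by apply: OB; exact: (lt_bdist_in s0 sx).
    rewrite product_measure1E//= lebesgue_measure_itv/= lte_fin ediam_gt0.
    by rewrite lte_mul_pinfty// ?lee_fin -?EFinD// subr0 ltW// ediam_gt0.
  - by rewrite m2E setTI lte_mul_pinfty// lee_fin.
  - move=> k c; rewrite mWE; last exact: measurable_dyad_cell.
    (* A dyadic cube meeting B is contained in B. One that misses B receives no ray, since rays stay
       in Omega until they arrive. *)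
    have [[v [/= vc Bv]]|nB] := pselect ([set v | dyad k v = c] `&` B !=set0).
      rewrite m2E (setIidl _); first exact: ray_cell_measure.
      move=> w /= wc; apply: (dyad_saturatedW (leq0n k) sB) Bv.
      by rewrite vc wc.
    rewrite (_ : W _ = set0) ?measure0//.
    rewrite -subset0 => -[s x] [/andP[/= s0 sx] /= cx]; apply: nB.
    exists (ray s x); split => //; apply: OB.
    exact: (ray_in oO projP s0 sx).
apply: (@le_trans _ _ (\int[mscale (NngNum Cge0) lam]_y phi y)).
  apply: ge0_le_measure_integral => //= A mA; apply: le_trans (mle _ mA) _.
  rewrite m2E /mscale/= lee_wpmul2l ?lee_fin//.
  by rewrite le_measure ?inE//; exact: measurableI.
by rewrite ge0_integral_mscale.
Qed.

End ray_bound.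

(** * The transport density as an image measure *)

Section distance_to_set.
Context {R : realType} {d : nat}.
Variable A : set 'rV[R]_d.
Hypothesis A0 : A !=set0.
Implicit Types x y z : 'rV[R]_d.

Let hasinf y : has_inf [set enorm (y - z) | z in A].
Proof.
split; first by have [z Az] := A0; exists (enorm (y - z)); exists z.
by exists 0 => _ [z _ <-]; exact: enorm_ge0.
Qed.

Lemma edist_set_le y z : A z -> edist_set y A <= enorm (y - z).
Proof. by move=> Az; apply: ge_inf; [exact: (hasinf y).2|exists z]. Qed.

Lemma edist_set_ge0 y : 0 <= edist_set y A.
Proof.
by apply: lb_le_inf; [exact: (hasinf y).1|move=> _ [z _ <-]; exact: enorm_ge0].
Qed.

Lemma edist_set_lipschitz x y : edist_set x A <= enorm (x - y) + edist_set y A.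
Proof.
rewrite -lerBlDl; apply: lb_le_inf; first exact: (hasinf y).1.
move=> _ [z Az <-]; rewrite lerBlDl (le_trans (edist_set_le x Az))//.
exact: ler_enorm_dist.
Qed.

Lemma continuous_edist_set : continuous (fun y => edist_set y A).
Proof.
move=> x B /nbhs_ballP[e /= e0 eB].
apply: (@filterS _ (nbhs x) _ _ _ _ (ltr_enorm_nbhs x e0)) => y yx; apply: eB.
have := edist_set_lipschitz x y; have := edist_set_lipschitz y x.
rewrite (enorm_distC x y) => h1 h2; rewrite /ball/= ltr_norml; apply/andP; split; lra.
Qed.

Lemma edist_set_gt0 y : closed A -> ~ A y -> 0 < edist_set y A.
Proof.
move=> cA nAy; rewrite lt_def edist_set_ge0 andbT; apply/eqP => dy.
apply: nAy; rewrite ((closure_id A).1 cA).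
move=> B /nbhs_ballP[e /= e0 eB].
have [_ [z Az <-]] := inf_adherent e0 (hasinf y); rewrite -/(edist_set y A) dy add0r => yz.
exists z; split => //; apply: eB; split=> // i j; rewrite ord1 /ball/=.
have := ler_coord_enorm (y - z) j; rewrite !mxE => /le_lt_trans; exact.
Qed.

End distance_to_set.

(** * Borel measures determined by continuous functions *)

Section measure_determined_by_continuous.
Context {R : realType} {d : nat}.
Local Open Scope ereal_scope.

Lemma measurable_fun_rV_continuous (phi : 'rV[R]_d -> R) : continuous phi ->
  measurable_fun [set: 'rV[R]_d] phi.
Proof.
move=> cphi; apply: (measurability (@RGenOpens.G R)); first exact: RGenOpens.measurableE.
move=> _ [_ [x [y ->]] <-]; rewrite setTI; apply: measurable_rV_open.
by apply: open_comp => [v _|]; [exact: cphi|exact: itv_open].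
Qed.

Variables m1 m2 : {measure set 'rV[R]_d -> \bar R}.
Hypothesis m1oo : m1 setT < +oo.
Hypothesis m12 : forall phi : 'rV[R]_d -> R, continuous phi ->
  (forall y, 0 <= phi y)%R -> \int[m1]_y (phi y)%:E = \int[m2]_y (phi y)%:E.

Let m12_open U : open U -> m1 U = m2 U.
Proof.
move=> oU; have mU : measurable U by exact: measurable_rV_open.
(* The distance to the complement makes sense only if the complement is nonempty; for the whole
   space the constant 1 is the test function. *)
have [A0|/set0P/negP/negPn/eqP A0] := pselect ((~` U) !=set0); last first.
  have -> : U = setT by rewrite -(setCK U) A0 setC0.
  have E (m : {measure set 'rV[R]_d -> \bar R}) : \int[m]_y (1%R)%:E = m setT.
    by rewrite integral_cst// mul1e.
  rewrite -!E; apply: (m12 (phi := cst 1%R)) => [|y]; [exact: cst_continuous|by rewrite /cst ler01].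
(* These continuous functions increase to the indicator of U, because the distance to the complement
   is positive exactly on U. *)
pose phi n y : R := Num.min 1%R (n%:R * edist_set y (~` U))%R.
have phi0 n y : (0 <= phi n y)%R.
  by rewrite le_min ler01 mulr_ge0// edist_set_ge0.
have cphi n : continuous (phi n).
  move=> y; apply: (@continuous_comp _ _ _ (fun y => edist_set y (~` U))
    (fun t => Num.min 1 (n%:R * t))%R); first exact: continuous_edist_set.
  apply: continuous_min; first exact: cvg_cst.
  by apply: cvgM; [exact: cvg_cst|exact: cvg_id].
have phiE y : (phi n y)%:E @[n --> \oo] --> (\1_U y)%:E.
  apply: cvg_near_cst; have [Uy|nUy] := pselect (U y); last first.
    apply: nearW => n; rewrite indicE memNset//; congr EFin; apply/eqP.
    rewrite eq_le phi0 andbT ge_min; apply/orP; right.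
    rewrite mulr_ge0_le0//; apply: (le_trans (edist_set_le A0 y (nUy : (~` U) y))).
    by rewrite subrr enorm0.
  have dy : (0 < edist_set y (~` U))%R.
    by apply: edist_set_gt0 => //; exact: open_closedC.
  exists (Num.truncn (edist_set y (~` U))^-1).+1 => // n /= Nn.
  rewrite indicE mem_set//; congr EFin; apply/min_idPl.
  rewrite -ler_pdivrMr// div1r (le_trans (ltW (truncnS_gt _)))//.
  by rewrite ler_nat.
have cvgm (m : {measure set 'rV[R]_d -> \bar R}) :
    \int[m]_y (phi n y)%:E @[n --> \oo] --> m U.
  have -> : m U = \int[m]_y limn (fun n => (phi n y)%:E).
    rewrite -[U]setIT -integral_indic//; apply: eq_integral => y _.
    by apply/esym/cvg_lim => //; rewrite setIT; exact: phiE.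
  apply: cvg_monotone_convergence => //.
  - by move=> n; apply/measurable_EFinP; exact: measurable_fun_rV_continuous.
  - by move=> n y _; rewrite lee_fin.
  - move=> y _ k l kl; rewrite lee_fin /phi le_min ge_min lexx/=.
    by rewrite ge_min ler_wpM2r ?edist_set_ge0 ?ler_nat// orbT.
have := cvgm m1; under eq_fun do rewrite m12//.
by move=> /(cvg_unique _) /(_ (cvgm m2)); exact.
Qed.

Lemma measure_eq_continuous A : measurable A -> m1 A = m2 A.
Proof.
rewrite rV_measurableE => mA.
apply: (@g_sigma_algebra_measure_unique _ _ _ (@open 'rV[R]_d) _ (fun=> setT)) => //.
- exact: measurable_rV_open.
- by move=> _; exact: openT.
- by rewrite bigcup_const.
- exact: openI.
Qed.

End measure_determined_by_continuous.

Section transport_density_as_ray_measure.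
Context {R : realType} {d : nat}.
Variables (Omega : set 'rV[R]_d) (P : 'rV[R]_d -> 'rV[R]_d).
Hypothesis oO : open Omega.
Hypothesis projP : borel_projection_selector Omega P.
Implicit Types (x y : 'rV[R]_d) (s : R).

Local Notation bdist := (bdist Omega P).
Local Notation ray := (ray Omega P).
Local Notation leb := (@lebesgue_measure R).
Local Notation lam := (lebesgue_rV R d).

Local Open Scope ereal_scope.

Let mO : measurable Omega. Proof. exact: measurable_rV_open. Qed.

(** Substitution s = b t. The right endpoint is left out to match the domain of the rays, where s <
    bdist x. *)
Lemma integral_scale01 (b : R) (G : R -> R) : (0 < b)%R -> continuous G ->
  \int[leb]_(t in `[0%R, 1%R]) (b * G (b * t))%:E =
  \int[leb]_(s in `[0%R, b[) (G s)%:E.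
Proof.
move=> b0 cG; pose F (t : R) : R := (b * t)%R.
have dF (t : R) : is_derive t (1 : R)%R F b.
  have := @is_deriveZ R R^o R^o (id : R -> R) b t 1%R 1%R _.
  by rewrite /GRing.scale/= mulr1; exact.
have F'E : derive1 F = cst b.
  by apply/funext => t; rewrite derive1E (@derive_val _ _ _ _ _ _ _ (dF t)).
have cF : continuous F by move=> t; apply: cvgM; [exact: cvg_cst|exact: cvg_id].
have := @integration_by_substitution_increasing R F G 0%R 1%R.
rewrite /F mulr0 mulr1 -/F => /(_ ler01) H.
rewrite [RHS]integral_itv_bndo_bndc; last first.
  by apply/measurable_EFinP/measurable_funTS; exact: continuous_measurable_fun.
rewrite H//.
- by apply: eq_integral => t _; rewrite F'E /= mulrC.
- by move=> u v _ _ uv; rewrite /F ltr_pM2l.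
- by rewrite F'E => t _; exact: cst_continuous.
- by rewrite F'E; exact: is_cvg_cst.
- by rewrite F'E; exact: is_cvg_cst.
- split.
  + by move=> t _; case: (dF t).
  + by apply: cvg_at_right_filter; exact: cF.
  + by apply: cvg_at_left_filter; exact: cF.
- exact: continuous_subspaceT.
Qed.

Lemma continuous_ray x : continuous (ray ^~ x).
Proof.
move=> s; apply: cvgD; first exact: cvg_cst.
apply: cvgZr_tmp; apply: cvgM; [exact: cvg_id|exact: cvg_cst].
Qed.

Variables (phi : 'rV[R]_d -> R).
Hypotheses (cphi : continuous phi) (phi0 : forall y, (0 <= phi y)%R).

Let mphi : measurable_fun [set: 'rV[R]_d] (EFin \o phi).
Proof. by apply/measurable_EFinP; exact: measurable_fun_rV_continuous. Qed.

Lemma segment_integral x : Omega x ->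
  \int[leb]_(t in `[0%R, 1%R])
    (enorm (x - P x) * phi ((1 - t) *: x + t *: P x))%:E =
  \int[leb]_(s in `[0%R, bdist x[) (phi (ray s x))%:E.
Proof.
move=> Ox; have b0 := bdist_gt0 oO projP Ox.
rewrite -(@integral_scale01 _ (phi \o ray ^~ x))//; last first.
  by move=> s; apply: continuous_comp; [exact: continuous_ray|exact: cphi].
apply: eq_integral => t _; rewrite /= -(bdistE P Ox); congr (_ * phi _)%:E.
rewrite /ray mulrAC mulfV ?gt_eqF// mul1r proj_extE//.
by apply/rowP => i; rewrite !mxE; ring.
Qed.

Variables (f : 'rV[R]_d -> R) (sigma : {measure set 'rV[R]_d -> \bar R}).
Hypothesis f0 : {ae lam, forall x, Omega x -> (0 <= f x)%R}.
Hypothesis mf : measurable_fun [set: 'rV[R]_d] (f \_ Omega).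
Hypothesis fsigma : is_transport_density Omega P f sigma.

(** f is nonnegative only almost everywhere on Omega. This version is nonnegative everywhere, as
    Tonelli and the image measures require, and equals the extension of f by 0 almost everywhere. *)
Definition pos_restrict : 'rV[R]_d -> R := fun x => Num.max ((f \_ Omega) x) 0%R.

Lemma pos_restrict_ge0 x : (0 <= pos_restrict x)%R.
Proof. by rewrite le_max lexx orbT. Qed.

Lemma measurable_pos_restrict : measurable_fun [set: 'rV[R]_d] pos_restrict.
Proof. by apply: measurable_maxr. Qed.

Lemma ae_pos_restrict : {ae lam, forall x, (f \_ Omega) x = pos_restrict x}.
Proof.
apply: filterS f0 => x fx; rewrite /pos_restrict; apply/esym/max_idPl.
by rewrite patchE; case: ifPn => // /set_mem.
Qed.

Lemma transport_density_ray_integral :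
  \int[sigma]_y (phi y)%:E =
  \int[leb \x lam]_z ((phi (ray z.1 z.2))%:E *
                      (ray_weight Omega P pos_restrict z)%:E).
Proof.
have mclO : measurable (closure Omega).
  rewrite -(setCK (closure Omega)); apply: measurableC; apply: measurable_rV_open.
  by apply: closed_openC; exact: closed_closure.
transitivity (\int[sigma]_(y in closure Omega) (phi y)%:E).
  rewrite [LHS](@ge0_negligible_integral _ _ _ _ _ (~` closure Omega))//.
  - by rewrite setDE setTI setCK.
  - exact: measurableC.
  - by move=> y _; rewrite lee_fin.
  - exact: fsigma.1.
rewrite fsigma.2; last exact: continuous_subspaceT.
have h0 x : 0 <= \int[leb]_(s in `[0%R, bdist x[) (phi (ray s x))%:E.
  by apply: integral_ge0 => s _; rewrite lee_fin.
transitivity (\int[lam]_(x in Omega) ((f x)%:E *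
   \int[leb]_(s in `[0%R, bdist x[) (phi (ray s x))%:E)).
  apply: eq_integral => x /set_mem Ox; rewrite -segment_integral//.
  pose g (t : R) : 'rV[R]_d := ((1 - t) *: x + t *: P x)%R.
  have cg : continuous g.
    move=> t; apply: cvgD; apply: cvgZr_tmp; last exact: cvg_id.
    by apply: cvgB; [exact: cvg_cst|exact: cvg_id].
  have cpg : continuous (phi \o g).
    by move=> t; apply: continuous_comp; [exact: cg|exact: cphi].
  (* f x may be negative on a null set, so it is pulled out through integrability of a continuous
     function on [0, 1] instead of nonnegativity. *)
  rewrite -integralZl//; last first.
    apply: (@continuous_compact_integrable _ (fun t => enorm (x - P x) * (phi \o g) t)%R).
      exact: segment_compact.
    apply: continuous_subspaceT => t.
    by apply: cvgM; [exact: cvg_cst|exact: cpg].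
  by apply: eq_integral => t _; rewrite -EFinM mulrC.
rewrite (ray_integralE oO projP pos_restrict_ge0 measurable_pos_restrict mphi)//.
set h := fun x => \int[leb]_(s in `[0%R, bdist x[) (phi (ray s x))%:E in h0 *.
have mh : measurable_fun [set: 'rV[R]_d] h.
  have := measurable_ray_inner oO projP (g := cst 1%R) (fun=> ler01)
    (measurable_cst _) mphi phi0.
  by under eq_fun do rewrite mul1e.
rewrite integral_mkcond.
transitivity (\int[lam]_x (((f \_ Omega) x)%:E * h x)).
  apply: eq_integral => x _; rewrite !patchE.
  by case: ifPn => // _; rewrite mul0e.
apply: ae_eq_integral => //.
- by apply: emeasurable_funM => //; exact/measurable_EFinP.
- by apply: emeasurable_funM => //; apply/measurable_EFinP; exact: measurable_pos_restrict.
- by apply: filterS ae_pos_restrict => x -> _.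
Qed.

End transport_density_as_ray_measure.

(** * Bounds on the transport density *)

Section weighted_rays.
Context {R : realType} {d : nat}.
Variables (Omega : set 'rV[R]_d) (r : R) (P : 'rV[R]_d -> 'rV[R]_d).
Hypotheses (oO : open Omega) (bO : bounded_set Omega) (r0 : 0 < r).
Hypothesis O0 : Omega !=set0.
Hypothesis extO : uniform_exterior_ball Omega r.
Hypothesis projP : borel_projection_selector Omega P.
Implicit Types (x y : 'rV[R]_d) (s : R).

Local Notation bdist := (bdist Omega P).
Local Notation ray := (ray Omega P).
Local Notation leb := (@lebesgue_measure R).
Local Notation lam := (lebesgue_rV R d).
Local Notation weight := (ray_weight Omega P).
Local Notation C := (@ray_const R d Omega r).

Local Open Scope ereal_scope.

Lemma measurable_ray_integrand (g : 'rV[R]_d -> R) (phi : 'rV[R]_d -> \bar R) :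
  measurable_fun [set: 'rV[R]_d] g -> measurable_fun [set: 'rV[R]_d] phi ->
  measurable_fun [set: measurableTypeR R * 'rV[R]_d]
    (fun z => phi (ray z.1 z.2) * (weight g z)%:E).
Proof.
move=> mg mphi; apply: emeasurable_funM.
  by apply: measurableT_comp => //; exact: (measurable_ray oO projP).
by apply/measurable_EFinP; exact: (measurable_ray_weight oO projP).
Qed.

(** The inner integral in s is the length of the ray, at most the diameter. The bound gives
    finiteness of the ray measure and also controls the term in f^p of the L^p estimate. *)
Lemma ray_weight_integral_le (g : 'rV[R]_d -> R) : (forall x, (0 <= g x)%R) ->
  measurable_fun [set: 'rV[R]_d] g ->
  \int[leb \x lam]_z (weight g z)%:E <= (ediam Omega)%:E * \int[lam]_x (g x)%:E.
Proof.
move=> g0 mg; have D0 := ediam_gt0 oO bO O0 projP.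
under eq_integral do rewrite -[_%:E]mul1e.
rewrite (ray_integralE oO projP g0 mg (phi := cst 1))//.
rewrite -ge0_integralZl//; last 3 first.
- exact/measurable_EFinP.
- by move=> x _; rewrite lee_fin.
- by rewrite lee_fin ltW.
apply: ge0_le_integral => //.
- move=> x _; rewrite mule_ge0 ?lee_fin//; exact: integral_ge0.
- exact: (measurable_ray_inner oO projP g0 mg (phi := cst 1)).
- by apply: emeasurable_funM => //; exact/measurable_EFinP.
- move=> x _; rewrite muleC lee_wpmul2r ?lee_fin//.
  rewrite integral_cst//= lebesgue_measure_itv/= lte_fin mul1e.
  case: ifPn => _; rewrite ?lee_fin ?(ltW D0)//.
  by rewrite subr0 (bdist_le_ediam bO O0 projP).
Qed.

Lemma ae_le_ray_integral (g h : 'rV[R]_d -> R) (phi : 'rV[R]_d -> \bar R) :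
  (forall x, (0 <= g x)%R) -> measurable_fun [set: 'rV[R]_d] g ->
  (forall x, (0 <= h x)%R) -> measurable_fun [set: 'rV[R]_d] h ->
  measurable_fun [set: 'rV[R]_d] phi -> (forall y, 0 <= phi y) ->
  {ae lam, forall x, (g x <= h x)%R} ->
  \int[leb \x lam]_z (phi (ray z.1 z.2) * (weight g z)%:E) <=
  \int[leb \x lam]_z (phi (ray z.1 z.2) * (weight h z)%:E).
Proof.
move=> g0 mg h0 mh mphi phi0 gh.
rewrite (ray_integralE oO projP g0 mg mphi phi0).
rewrite (ray_integralE oO projP h0 mh mphi phi0).
have i0 x : 0 <= \int[leb]_(s in `[0%R, bdist x[) phi (ray s x).
  exact: integral_ge0.
apply: ae_ge0_le_integral => //.
- by move=> x _; rewrite mule_ge0// lee_fin.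
- exact: (measurable_ray_inner oO projP g0 mg mphi phi0).
- by move=> x _; rewrite mule_ge0// lee_fin.
- exact: (measurable_ray_inner oO projP h0 mh mphi phi0).
- by apply: filterS gh => x gx _; rewrite lee_wpmul2r// lee_fin.
Qed.

Lemma ray_integralZ (M : R) (phi : 'rV[R]_d -> \bar R) : (0 <= M)%R ->
  measurable_fun [set: 'rV[R]_d] phi -> (forall y, 0 <= phi y) ->
  \int[leb \x lam]_z (phi (ray z.1 z.2) * (weight (cst M) z)%:E) <=
  (M * C)%:E * \int[lam]_y phi y.
Proof.
move=> M0 mphi phi0; rewrite EFinM -muleA.
rewrite (_ : \int[_]_z _ = M%:E *
    \int[leb \x lam]_z (phi (ray z.1 z.2) * (weight (cst 1%R) z)%:E)).
  rewrite lee_wpmul2l ?lee_fin//.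
  exact: (ray_integral_le oO bO r0 O0 extO projP mphi phi0).
rewrite -ge0_integralZl//.
- by apply: eq_integral => z _; rewrite /ray_weight/= mul1r EFinM muleCA.
- exact: (measurable_ray_integrand (measurable_cst _) mphi).
- by move=> z _; rewrite mule_ge0// lee_fin; apply: ray_weight_ge0 => ?; exact: ler01.
Qed.

(* If phi vanishes almost everywhere, so does its average along almost every
   ray, whatever the (possibly unbounded) weight of the ray. *)
Lemma ray_integral_eq0 (g : 'rV[R]_d -> R) (phi : 'rV[R]_d -> \bar R) :
  (forall x, (0 <= g x)%R) -> measurable_fun [set: 'rV[R]_d] g ->
  measurable_fun [set: 'rV[R]_d] phi -> (forall y, 0 <= phi y) ->
  \int[lam]_y phi y = 0 ->
  \int[leb \x lam]_z (phi (ray z.1 z.2) * (weight g z)%:E) = 0.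
Proof.
move=> g0 mg mphi phi0 phi_eq0.
have one0 (x : 'rV[R]_d) : (0 <= cst 1 x :> R)%R by exact: ler01.
have m1 : measurable_fun [set: 'rV[R]_d] (cst 1%R : 'rV[R]_d -> R).
  exact: measurable_cst.
have : \int[leb \x lam]_z (phi (ray z.1 z.2) * (weight (cst 1%R) z)%:E) = 0.
  apply/eqP; rewrite eq_le; apply/andP; split; last first.
    apply: integral_ge0 => z _; rewrite mule_ge0// lee_fin.
    exact: ray_weight_ge0.
  rewrite (le_trans (ray_integral_le oO bO r0 O0 extO projP mphi phi0))//.
  by rewrite phi_eq0 mule0.
rewrite (ray_integralE oO projP one0 m1 mphi phi0).
rewrite (ray_integralE oO projP g0 mg mphi phi0).
have mi := measurable_ray_inner oO projP one0 m1 mphi phi0.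
have mg' := measurable_ray_inner oO projP g0 mg mphi phi0.
have i0 x : 0 <= \int[leb]_(s in `[0%R, bdist x[) phi (ray s x).
  exact: integral_ge0.
move=> H; have : \int[lam]_x `| (cst 1%R x)%:E *
    \int[leb]_(s in `[0%R, bdist x[) phi (ray s x) | = 0.
  rewrite -[RHS]H; apply: eq_integral => x _; rewrite gee0_abs//.
  by rewrite mule_ge0// lee_fin.
move=> /(ae_eq_integral_abs _ measurableT mi) ae0.
rewrite (ae_eq_integral (cst 0))//; first by rewrite integral0.
apply: filterS ae0 => x /(_ I); rewrite mul1e => -> _.
by rewrite mule0.
Qed.

End weighted_rays.

Section power_inequality.
Context {R : realType}.

(** Plays the role of the Young inequality, without conjugate exponents. If a <= e b, the first term
    alone dominates; otherwise b < a / e, and monotonicity of the power p - 1 gives the second. *)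
Lemma powR_split (a b e p : R) : 0 <= a -> 0 <= b -> 0 < e -> 1 <= p ->
  a * b `^ (p - 1) <= e * b `^ p + e `^ (1 - p) * a `^ p.
Proof.
move=> a0 b0 e0 p1.
have p0 : p != 0 by rewrite gt_eqF// (lt_le_trans ltr01).
have mulp (x : R) : 0 <= x -> x * x `^ (p - 1) = x `^ p.
  move=> x0; have [->|xn0] := eqVneq x 0; first by rewrite mul0r powR0.
  rewrite -{1}(powRr1 x0) -powRD; last by rewrite xn0 implybT.
  by rewrite addrC subrK.
have [ab|ab] := leP a (e * b).
  rewrite (@le_trans _ _ (e * b `^ p))//.
    by rewrite -(mulp _ b0) mulrA ler_wpM2r// powR_ge0.
  by rewrite lerDl mulr_ge0// powR_ge0.
rewrite (@le_trans _ _ (e `^ (1 - p) * a `^ p))//; last first.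
  by rewrite lerDr mulr_ge0// ?powR_ge0// ltW.
rewrite -(mulp _ a0) mulrCA ler_wpM2l//.
have -> : e `^ (1 - p) = e^-1 `^ (p - 1).
  by rewrite -opprB powRN -[in LHS]powR_inv1 ?powR_ge0// powRAC powR_inv1 ?ltW.
rewrite -powRM ?invr_ge0 ?(ltW e0)//.
apply: ge0_ler_powR; rewrite ?nnegrE ?subr_ge0 ?mulr_ge0 ?invr_ge0 ?(ltW e0)//.
by rewrite mulrC ler_pdivlMr// mulrC ltW.
Qed.

End power_inequality.

Section integral_bound.
Context {disp} {T : measurableType disp} {R : realType}.
Variable mu : {measure set T -> \bar R}.
Local Open Scope ereal_scope.

(** Testing on the part of D where s > c, the integral of s - c is at most 0, although the integrand
    is positive there; finiteness of mu D permits the subtraction. *)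
Lemma ae_le_of_integral_le (D : set T) (s : T -> R) (c : R) : measurable D ->
  mu D < +oo -> measurable_fun [set: T] s -> (forall x, (0 <= s x)%R) ->
  (0 <= c)%R ->
  (forall A, measurable A -> \int[mu]_(x in A) (s x)%:E <= c%:E * mu A) ->
  {ae mu, forall x, D x -> (s x <= c)%R}.
Proof.
move=> mD Doo ms s0 c0 H.
pose B := D `&` [set x | (c < s x)%R].
have mB : measurable B.
  apply: measurableI => //; rewrite -[X in measurable X]setTI.
  have mb : measurable_fun [set: T] (fun x => c < s x)%R.
    exact: measurable_fun_ltr.
  exact: (mb measurableT [set true]).
have Boo : mu B < +oo.
  by apply: le_lt_trans Doo; rewrite le_measure ?inE//; exact: subIsetl.
have msc : measurable_fun B (fun x => (s x - c)%:E).
  by apply/measurable_EFinP/measurable_funTS; apply: measurable_funB.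
have sc0 x : B x -> 0 <= (s x - c)%:E.
  by move=> [_ /= /ltW]; rewrite lee_fin subr_ge0.
have : \int[mu]_(x in B) `|(s x - c)%:E| = 0.
  rewrite (eq_integral (fun x => (s x - c)%:E)); last first.
    by move=> x /set_mem Bx; rewrite gee0_abs// sc0.
  apply/eqP; rewrite eq_le integral_ge0// andbT.
  have := H _ mB.
  rewrite (eq_integral (fun x => (s x - c)%:E + c%:E)); last first.
    by move=> x _; rewrite -EFinD subrK.
  rewrite ge0_integralD//.
  rewrite integral_cst// => h.
  have cB : c%:E * mu B \is a fin_num.
    by rewrite fin_numM// ge0_fin_numE.
  by rewrite -(leeD2rE _ _ cB) add0e.
move=> /(ae_eq_integral_abs _ mB msc); apply: filterS => x /= h Dx.
rewrite leNgt; apply/negP => cs; have := h (conj Dx cs) => /eqP.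
by rewrite eqe subr_eq0 => /eqP sc; rewrite sc ltxx in cs.
Qed.

End integral_bound.

Section transport_density_bounds.
Context {R : realType} {d : nat}.
Variables (Omega : set 'rV[R]_d) (r : R) (P : 'rV[R]_d -> 'rV[R]_d).
Hypotheses (oO : open Omega) (bO : bounded_set Omega) (r0 : 0 < r).
Hypothesis O0 : Omega !=set0.
Hypothesis extO : uniform_exterior_ball Omega r.
Hypothesis projP : borel_projection_selector Omega P.
Variables (f : 'rV[R]_d -> R) (sigma : {measure set 'rV[R]_d -> \bar R}).
Implicit Types (x y : 'rV[R]_d) (s : 'rV[R]_d -> R).

Local Notation ray := (ray Omega P).
Local Notation leb := (@lebesgue_measure R).
Local Notation lam := (lebesgue_rV R d).
Local Notation weight := (ray_weight Omega P).
Local Notation C := (@ray_const R d Omega r).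
Local Notation fp := (pos_restrict Omega f).

Local Open Scope ereal_scope.

Hypothesis f0 : {ae lam, forall x, Omega x -> (0 <= f x)%R}.
Hypothesis mf : measurable_fun [set: 'rV[R]_d] (f \_ Omega).
Hypothesis fsigma : is_transport_density Omega P f sigma.
Hypothesis foo : \int[lam]_x (fp x)%:E < +oo.

Let fp0 x : (0 <= fp x)%R. Proof. exact: pos_restrict_ge0. Qed.

Let mfp : measurable_fun [set: 'rV[R]_d] fp.
Proof. exact: measurable_pos_restrict. Qed.

Let mO : measurable Omega. Proof. exact: measurable_rV_open. Qed.

Let Ooo : lam Omega < +oo. Proof. exact: (bounded_lebesgue_lty bO mO). Qed.

(** The definition of the transport density speaks of continuous test functions only. The ray
    measure is finite and gives them the same integrals, so it equals [sigma] on Borel sets, and the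
    formula extends to Borel integrands. *)
Lemma transport_density_integralE (phi : 'rV[R]_d -> \bar R) :
  measurable_fun [set: 'rV[R]_d] phi -> (forall y, 0 <= phi y) ->
  \int[sigma]_y phi y =
  \int[leb \x lam]_z (phi (ray z.1 z.2) * (weight fp z)%:E).
Proof.
move=> mphi phi0; have [m mE] := ray_measure_exists oO projP fp0 mfp.
have moo : m setT < +oo.
  rewrite -[m setT]mul1e -integral_cst// mE//.
  under eq_integral do rewrite mul1e.
  apply: le_lt_trans (ray_weight_integral_le oO bO O0 projP fp0 mfp) _.
  rewrite lte_mul_pinfty// ?lee_fin ?ltW ?(ediam_gt0 oO bO O0 projP)//.
rewrite -mE//; apply: eq_measure_integral => A mA _; apply/esym.
apply: (measure_eq_continuous moo) => // psi cpsi psi0.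
rewrite (transport_density_ray_integral oO projP cpsi psi0 f0 mf fsigma) mE//.
by apply/measurable_EFinP; exact: measurable_fun_rV_continuous.
Qed.

Lemma transport_density_finite : sigma setT < +oo.
Proof.
rewrite -[sigma setT]mul1e -integral_cst// transport_density_integralE//.
under eq_integral do rewrite mul1e.
apply: le_lt_trans (ray_weight_integral_le oO bO O0 projP fp0 mfp) _.
by rewrite lte_mul_pinfty// ?lee_fin ?ltW ?(ediam_gt0 oO bO O0 projP).
Qed.

Let sigmaE A : measurable A -> sigma A = \int[sigma]_y (\1_A y)%:E.
Proof. by move=> mA; rewrite integral_indic// setIT. Qed.

Let mindic A : measurable A ->
  measurable_fun [set: 'rV[R]_d] (fun y => (\1_A y)%:E : \bar R).
Proof. by move=> mA; apply/measurable_EFinP; exact: measurable_indic. Qed.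

Let indic0 A y : 0 <= (\1_A y)%:E :> \bar R. Proof. by rewrite lee_fin. Qed.

(** Absolute continuity, the input of Radon-Nikodym. As f may be unbounded, it rests on the
    vanishing along almost every ray and not on a bound by a multiple of Lebesgue measure. *)
Lemma transport_density_null A : measurable A -> lam A = 0 -> sigma A = 0.
Proof.
move=> mA A0; rewrite sigmaE// (transport_density_integralE (mindic mA) (indic0 A)).
apply: (ray_integral_eq0 oO bO r0 O0 extO projP fp0 mfp (mindic mA) (indic0 A)).
by rewrite integral_indic// setIT.
Qed.

Lemma lebesgue_density_exists : exists s, is_lebesgue_density sigma s.
Proof.
(* Restricting to the whole space only packages [sigma] as a finite measure. *)
pose nu : {finite_measure set 'rV[R]_d -> \bar R} :=
  mfrestr measurableT transport_density_finite.
have nuE A : nu A = sigma A by rewrite /nu/= /mfrestr /mrestr setIT.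
have nulam : nu `<< lam.
  apply/null_content_dominatesP => A mA A0; rewrite nuE.
  exact: transport_density_null.
have [g [g0 gfin gint gE]] := radon_nikodym_sigma_finite nulam.
exists (fine \o g); split.
- by apply: measurableT_comp => //; exact: (measurable_int lam gint).
- by move=> y; rewrite fine_ge0.
- move=> A mA; rewrite -nuE gE//; apply: eq_integral => y _.
  by rewrite /= fineK.
Qed.

Lemma lebesgue_density_integral s (phi : 'rV[R]_d -> \bar R) :
  is_lebesgue_density sigma s ->
  measurable_fun [set: 'rV[R]_d] phi -> (forall y, 0 <= phi y) ->
  \int[sigma]_y phi y = \int[lam]_y (phi y * (s y)%:E).
Proof.
move=> [ms s0 sE] mphi phi0; rewrite -(ge0_integral_mdensity lam s0 ms)//.
by apply: eq_measure_integral => A mA _; exact: sE.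
Qed.

Lemma density_le_ae s (M : R) : is_lebesgue_density sigma s -> (0 <= M)%R ->
  {ae lam, forall x, (fp x <= M)%R} ->
  {ae lam, forall y, Omega y -> (s y <= M * C)%R}.
Proof.
move=> [ms s0 sE] M0 fM; apply: ae_le_of_integral_le => //.
  by rewrite mulr_ge0// (ray_const_ge0 oO bO r0 O0 projP).
move=> A mA; rewrite -sE// sigmaE// (transport_density_integralE (mindic mA) (indic0 A)).
apply: le_trans (ae_le_ray_integral oO projP (h := cst M) fp0 mfp _ _ (mindic mA) (indic0 A) fM) _.
- by move=> x.
- exact: measurable_cst.
apply: le_trans (ray_integralZ oO bO r0 O0 extO projP M0 (mindic mA) (indic0 A)) _.
by rewrite integral_indic// setIT.
Qed.

Section Lp_bound.
Variables (p : R) (s : 'rV[R]_d -> R).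
Hypothesis p1 : (1 <= p)%R.
Hypothesis ds : is_lebesgue_density sigma s.
Hypothesis fpoo : \int[lam]_x (fp x `^ p)%:E < +oo.

Let ms : measurable_fun [set: 'rV[R]_d] s. Proof. by case: ds. Qed.
Let s0 y : (0 <= s y)%R. Proof. by case: ds. Qed.

(** Truncation level: on [E k] the density is bounded and Omega has finite measure, so [X k] is
    finite before any estimate. *)
Let E (k : nat) := Omega `&` [set y | (s y <= k%:R)%R].

Let mE k : measurable (E k).
Proof.
apply: measurableI => //; rewrite -[X in measurable X]setTI.
have mb : measurable_fun [set: 'rV[R]_d] (fun y => s y <= k%:R)%R.
  exact: measurable_fun_ler.
exact: (mb measurableT [set true]).
Qed.

Let mpow (g : 'rV[R]_d -> R) q : measurable_fun [set: 'rV[R]_d] g ->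
  measurable_fun [set: 'rV[R]_d] (fun y => (g y `^ q)%R).
Proof. by move=> mg; exact: (measurableT_comp (measurable_powR q)). Qed.

Let p0 : p != 0%R. Proof. by rewrite gt_eqF// (lt_le_trans ltr01). Qed.

Let X k := \int[lam]_(y in E k) (s y `^ p)%:E.

Let X_fin k : X k < +oo.
Proof.
apply: (@le_lt_trans _ _ (\int[lam]_(y in E k) (k%:R `^ p)%:E)).
  apply: ge0_le_integral => //.
  - by move=> y _; rewrite lee_fin powR_ge0.
  - by apply/measurable_EFinP/measurable_funTS; exact: mpow.
  - move=> y [_ /= sk]; rewrite lee_fin ge0_ler_powR ?nnegrE//.
    exact: le_trans ler01 p1.
rewrite integral_cst// lte_mul_pinfty ?lee_fin ?powR_ge0//.
by apply: le_lt_trans Ooo; rewrite le_measure ?inE//; exact: subIsetl.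
Qed.

(** Chosen so that e C <= 1/2, which leaves half of [X k] to absorb; C + 1 keeps the denominator
    positive when only C >= 0 is known. *)
Let e : R := (2 * (C + 1))^-1.

Let C0 : (0 <= C)%R. Proof. exact: (ray_const_ge0 oO bO r0 O0 projP). Qed.

Let e0 : (0 < e)%R.
Proof. by rewrite invr_gt0 mulr_gt0// ltr_wpDl. Qed.

Let Y := (e `^ (1 - p))%:E * ((ediam Omega)%:E * \int[lam]_x (fp x `^ p)%:E).

Let X_step k : X k <= (2^-1)%:E * X k + Y.
Proof.
pose phi y : \bar R := (s y `^ (p - 1) * \1_(E k) y)%:E.
pose psi y : \bar R := (s y `^ p * \1_(E k) y)%:E.
have mphi : measurable_fun [set: 'rV[R]_d] phi.
  by apply/measurable_EFinP; apply: measurable_funM; [exact: mpow|exact: measurable_indic].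
have mpsi : measurable_fun [set: 'rV[R]_d] psi.
  by apply/measurable_EFinP; apply: measurable_funM; [exact: mpow|exact: measurable_indic].
have phi0 y : 0 <= phi y by rewrite lee_fin mulr_ge0// powR_ge0.
have psi0 y : 0 <= psi y by rewrite lee_fin mulr_ge0// powR_ge0.
have XE : X k = \int[lam]_y psi y.
  rewrite /X integral_mkcond; apply: eq_integral => y _.
  by rewrite patchE /psi indicE; case: ifPn => _; rewrite ?mulr1 ?mulr0.
(* Integrating the truncated s^(p-1) against [sigma], whose density is s, restores s^p. The law of
   exponents needs s y != 0, hence the case split. *)
have XE' : X k = \int[sigma]_y phi y.
  rewrite (lebesgue_density_integral ds mphi phi0) XE; apply: eq_integral => y _.
  rewrite /psi /phi -EFinM mulrAC; congr (_ * _)%:E.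
  have [->|sn0] := eqVneq (s y) 0%R; first by rewrite mulr0 powR0.
  rewrite -{3}(powRr1 (s0 y)) -powRD; last by rewrite sn0 implybT.
  by rewrite subrK.
rewrite {1}XE' (transport_density_integralE mphi phi0).
have fpp0 x : (0 <= fp x `^ p)%R by exact: powR_ge0.
have mfpp : measurable_fun [set: 'rV[R]_d] (fun x => fp x `^ p)%R by exact: mpow.
have ce0 (x : 'rV[R]_d) : (0 <= cst e x :> R)%R by exact: ltW.
have mce : measurable_fun [set: 'rV[R]_d] (cst e) by exact: measurable_cst.
have w0 (g : 'rV[R]_d -> R) z : (forall x, 0 <= g x)%R -> 0 <= (weight g z)%:E.
  by move=> g0; rewrite lee_fin ray_weight_ge0.
have mw (g : 'rV[R]_d -> R) : measurable_fun [set: 'rV[R]_d] g ->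
    measurable_fun [set: measurableTypeR R * 'rV[R]_d] (EFin \o weight g).
  by move=> mg; apply/measurable_EFinP; exact: (measurable_ray_weight oO projP).
(* Pointwise [powR_split] with a = fp x and b the density at the point reached by the ray. The first
   term keeps the truncation, so that it returns [X k]; the second drops it. *)
apply: (@le_trans _ _ (\int[leb \x lam]_z
   (psi (ray z.1 z.2) * (weight (cst e) z)%:E +
    (e `^ (1 - p))%:E * (weight (fun x => fp x `^ p)%R z)%:E))).
  apply: ge0_le_integral => //.
  - by move=> z _; rewrite mule_ge0// w0.
  - exact: (measurable_ray_integrand oO projP mfp mphi).
  - apply: emeasurable_funD; first exact: (measurable_ray_integrand oO projP mce mpsi).
    by apply: emeasurable_funM; [exact: measurable_cst|exact: mw].
  - move=> [t x] _ /=; rewrite /phi /psi /ray_weight -!EFinM -EFinD lee_fin/=.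
    have := powR_split (fp0 x) (s0 (ray t x)) e0 p1.
    rewrite !indicE; case: (_ \in E k) => /=; case: (_ \in raydom _ _) => /=;
      rewrite ?mulr1 ?mulr0 ?mul0r ?addr0 ?add0r//.
      by rewrite (mulrC (fp x)) (mulrC e).
    by move=> _; rewrite mulr_ge0 ?powR_ge0.
rewrite ge0_integralD//; last 4 first.
- by move=> z _; rewrite mule_ge0// w0.
- exact: (measurable_ray_integrand oO projP mce mpsi).
- by move=> z _; rewrite mule_ge0 ?w0// lee_fin powR_ge0.
- by apply: emeasurable_funM; [exact: measurable_cst|exact: mw].
apply: leeD.
  apply: le_trans (ray_integralZ oO bO r0 O0 extO projP (ltW e0) mpsi psi0) _.
  have Xk0 : 0 <= X k by apply: integral_ge0 => y _; rewrite lee_fin powR_ge0.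
  rewrite -XE lee_wpmul2r ?lee_fin//.
  rewrite /e invfM -mulrA ger_pMr ?invr_gt0// ler_pdivrMl ?ltr_wpDl// mulr1.
  by rewrite lerDl.
rewrite ge0_integralZl//; last 3 first.
- exact: mw.
- by move=> z _; rewrite w0.
- by rewrite lee_fin powR_ge0.
rewrite lee_wpmul2l ?lee_fin ?powR_ge0//.
exact: (ray_weight_integral_le oO bO O0 projP fpp0 mfpp).
Qed.

Lemma density_Lp_integral : \int[lam]_(y in Omega) (s y `^ p)%:E < +oo.
Proof.
have Yfin : Y < +oo.
  rewrite lte_mul_pinfty ?lee_fin ?powR_ge0// lte_mul_pinfty//.
  by rewrite lee_fin ltW// (ediam_gt0 oO bO O0 projP).
have Y0 : 0 <= Y.
  apply: mule_ge0; first by rewrite lee_fin powR_ge0.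
  apply: mule_ge0; first by rewrite lee_fin ltW// (ediam_gt0 oO bO O0 projP).
  by apply: integral_ge0 => x _; rewrite lee_fin powR_ge0.
(* From X <= X / 2 + Y with X finite; the bound is uniform in k, so it passes to the limit by
   monotone convergence. *)
have X2Y k : X k <= 2%:E * Y.
  have X0 : 0 <= X k by apply: integral_ge0 => y _; rewrite lee_fin powR_ge0.
  have := X_step k; rewrite -(@fineK _ (X k)) ?ge0_fin_numE//.
  rewrite -(@fineK _ Y) ?ge0_fin_numE// -!EFinM -EFinD !lee_fin; lra.
have UE : \bigcup_k E k = Omega.
  apply/seteqP; split => [y [k _ []//]|y Oy].
  exists (Num.truncn (s y)).+1 => //; split => //=.
  by rewrite ltW// truncnS_gt.
rewrite -UE; have EX : X k @[k --> \oo] --> \int[lam]_(y in \bigcup_k E k) (s y `^ p)%:E.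
  apply: ge0_nondecreasing_set_cvg_integral => //.
  - apply/nondecreasing_seqP => k; apply/subsetPset => y [Oy /= sk]; split => //=.
    by rewrite (le_trans sk)// ler_nat.
  - by move=> k; apply/measurable_EFinP/measurable_funTS; exact: mpow.
  - by move=> k y _; rewrite lee_fin powR_ge0.
apply: (@le_lt_trans _ _ (2%:E * Y)); last by rewrite lte_mul_pinfty.
rewrite -(cvg_lim _ EX)//; apply: lime_le; first by apply/cvg_ex; eexists; exact: EX.
by apply: nearW => k; exact: X2Y.
Qed.

End Lp_bound.

End transport_density_bounds.

(** * Lp norms on the domain *)

Section Lp_restriction.
Context {R : realType} {d : nat}.
Variables (Omega : set 'rV[R]_d).
Local Notation lam := (lebesgue_rV R d).
Local Open Scope ereal_scope.

Lemma Lp_onP (p : \bar R) (f : 'rV[R]_d -> R) : Lp_on Omega p f <->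
  measurable_fun [set: 'rV[R]_d] (f \_ Omega) /\ Lp_norm_on Omega p f < +oo.
Proof.
rewrite /Lp_on inE/= /Lp_norm_on; split.
  by move=> /andP[]; rewrite inE/= => mf; rewrite inE/= => foo; split.
by move=> [mf foo]; apply/andP; split; rewrite inE.
Qed.

Lemma Lp_on_finP (p : R) (f : 'rV[R]_d -> R) : (1 <= p)%R -> Lp_on Omega p%:E f <->
  measurable_fun [set: 'rV[R]_d] (f \_ Omega) /\
  \int[lam]_x (`|(f \_ Omega) x| `^ p)%:E < +oo.
Proof.
move=> p1; have p0 : p != 0%R by rewrite gt_eqF// (lt_le_trans ltr01).
apply: (iff_trans (Lp_onP _ _)); rewrite /Lp_norm_on; split => -[mf foo]; split => //.
  by have := poweR_lty p foo; rewrite poweR_Lnorm.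
by rewrite unlock; apply: poweR_lty.
Qed.

Lemma Lp_norm_on_pinfty_le (f : 'rV[R]_d -> R) (M : \bar R) : 0 <= M ->
  {ae lam, forall x, `|((f \_ Omega) x)%:E| <= M} -> Lp_norm_on Omega +oo f <= M.
Proof.
by move=> M0 fM; rewrite /Lp_norm_on unlock; case: ifPn => // _; apply/ess_supP.
Qed.

Lemma ae_le_Lp_norm_on_pinfty (f : 'rV[R]_d -> R) :
  {ae lam, forall x, `|((f \_ Omega) x)%:E| <= Lp_norm_on Omega +oo f}.
Proof.
rewrite /Lp_norm_on unlock; case: ifPn => [_|]; first exact: ess_sup_ge.
(* The L^oo norm is an essential supremum only when the whole space has positive measure; otherwise
   every property holds almost everywhere. *)
rewrite -leNgt => T0; exists setT; split => //.
by apply/eqP; rewrite eq_le T0/=.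
Qed.

Lemma pos_restrict_le_normr (f : 'rV[R]_d -> R) x :
  (pos_restrict Omega f x <= `|(f \_ Omega) x|)%R.
Proof. by rewrite /pos_restrict ge_max normr_ge0 ler_norm. Qed.

End Lp_restriction.

Section Lp_transport.
Context {R : realType} {d : nat}.
Variables (Omega : set 'rV[R]_d).
Hypotheses (oO : open Omega) (bO : bounded_set Omega).
Variable f : 'rV[R]_d -> R.
Local Notation lam := (lebesgue_rV R d).
Local Notation fp := (pos_restrict Omega f).
Local Open Scope ereal_scope.

Let mO : measurable Omega. Proof. exact: measurable_rV_open. Qed.

Lemma pos_restrict_out x : ~ Omega x -> fp x = 0%R.
Proof. by move=> nOx; rewrite /pos_restrict patchE memNset// maxxx. Qed.

Lemma Lp_on_pinfty_pos_restrict : Lp_on Omega +oo f ->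
  let M := fine (Lp_norm_on Omega +oo f) in
  [/\ (0 <= M)%R, {ae lam, forall x, (fp x <= M)%R} & \int[lam]_x (fp x)%:E < +oo].
Proof.
move=> /Lp_onP[mf Noo] M; have N0 : 0 <= Lp_norm_on Omega +oo f by exact: Lnorm_ge0.
have M0 : (0 <= M)%R by exact: fine_ge0.
have ME : Lp_norm_on Omega +oo f = M%:E by rewrite fineK// ge0_fin_numE.
have fM : {ae lam, forall x, (fp x <= M)%R}.
  apply: filterS (ae_le_Lp_norm_on_pinfty Omega f) => x.
  by rewrite ME lee_fin; exact: le_trans (pos_restrict_le_normr _ _ _).
split => //; apply: (@le_lt_trans _ _ (\int[lam]_(x in Omega) M%:E)); last first.
  by rewrite integral_cst// lte_mul_pinfty// (bounded_lebesgue_lty bO (measurable_rV_open oO)).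
rewrite [leRHS]integral_mkcond; apply: ae_ge0_le_integral => //.
- by move=> x _; rewrite lee_fin pos_restrict_ge0.
- by apply/measurable_EFinP; exact: measurable_pos_restrict.
- by move=> x _; rewrite patchE; case: ifPn => //; rewrite lee_fin.
- by apply/(measurable_restrictT _ mO); exact: measurable_cst.
- apply: filterS fM => x fx _; rewrite patchE; case: ifPn => [_|nOx].
    by rewrite lee_fin.
  by rewrite pos_restrict_out// => /mem_set; exact/negP.
Qed.

Lemma Lp_on_pos_restrict (p : R) : (1 <= p)%R -> Lp_on Omega p%:E f ->
  \int[lam]_x (fp x `^ p)%:E < +oo /\ \int[lam]_x (fp x)%:E < +oo.
Proof.
move=> p1 /(Lp_on_finP _ _ p1)[mf foo].
have mfp := measurable_pos_restrict mf.
have mfpp : measurable_fun [set: 'rV[R]_d] (fun x => (fp x `^ p)%:E).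
  by apply/measurable_EFinP; exact: (measurableT_comp (measurable_powR p)).
have fpoo : \int[lam]_x (fp x `^ p)%:E < +oo.
  apply: le_lt_trans foo; apply: ge0_le_integral => //.
  - by move=> x _; rewrite lee_fin powR_ge0.
  - apply/measurable_EFinP; apply: (measurableT_comp (measurable_powR p)).
    exact: measurableT_comp.
  - move=> x _; rewrite lee_fin ge0_ler_powR ?nnegrE ?pos_restrict_ge0//.
      exact: le_trans p1.
    exact: pos_restrict_le_normr.
split => //.
(* L^p is contained in L^1 here through t <= 1 + t^p on Omega, which has finite measure. *)
apply: (@le_lt_trans _ _ (\int[lam]_x ((\1_Omega x)%:E + (fp x `^ p)%:E))).
  apply: ge0_le_integral => //.
  - by move=> x _; rewrite lee_fin pos_restrict_ge0.
  - exact/measurable_EFinP.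
  - by apply: emeasurable_funD => //; apply/measurable_EFinP; exact: measurable_indic.
  - move=> x _; rewrite -EFinD lee_fin.
    have [Ox|nOx] := pselect (Omega x); last first.
      by rewrite pos_restrict_out// addr_ge0// powR_ge0.
    rewrite indicE mem_set//; have [f1|f1] := leP (fp x) 1%R.
      by rewrite (le_trans f1)// lerDl powR_ge0.
    rewrite (@le_trans _ _ (fp x `^ p)%R)// ?lerDr//.
    by rewrite -{1}(powRr1 (pos_restrict_ge0 Omega f x)) ler_powR// ltW.
rewrite ge0_integralD//.
- rewrite integral_indic// setIT lte_add_pinfty//.
  exact: (bounded_lebesgue_lty bO (measurable_rV_open oO)).
- by apply/measurable_EFinP; exact: measurable_indic.
- by move=> x _; rewrite lee_fin powR_ge0.
Qed.

End Lp_transport.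

Theorem mainTheorem5 (R : realType) :
  exists C : nat -> R -> R -> R,
  forall (d : nat) (Omega : set 'rV[R]_d) (r : R) (P : 'rV[R]_d -> 'rV[R]_d),
    (0 < d)%N -> bounded_domain Omega ->
    0 < r -> uniform_exterior_ball Omega r ->
    borel_projection_selector Omega P ->
    (forall f : 'rV[R]_d -> R,
       {ae lebesgue_rV R d, forall x, Omega x -> 0 <= f x} ->
       Lp_on Omega +oo%E f ->
       forall sigma : {measure set 'rV[R]_d -> \bar R},
       is_transport_density Omega P f sigma ->
       exists2 s : 'rV[R]_d -> R, is_lebesgue_density sigma s &
         {ae lebesgue_rV R d, forall y, Omega y ->
            s y <= C d r (ediam Omega) * fine (Lp_norm_on Omega +oo%E f)
                   / (r + edist_set y (boundary Omega)) ^+ d.-1}) /\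
    (forall (p : \bar R) (f : 'rV[R]_d -> R),
       (1 <= p)%E ->
       {ae lebesgue_rV R d, forall x, Omega x -> 0 <= f x} ->
       Lp_on Omega p f ->
       forall sigma : {measure set 'rV[R]_d -> \bar R},
       is_transport_density Omega P f sigma ->
       exists2 s : 'rV[R]_d -> R, is_lebesgue_density sigma s &
         Lp_on Omega p s).
Proof.
(* The first factor is [ray_const]; the second, (r + D)^(d-1), bounds the denominator of the
   weighted estimate because d(y, boundary) <= D. *)
exists (fun d r D => (D * (2 * (d%:R * ((r + D) / r))) ^+ d) * (r + D) ^+ d.-1).
move=> d Omega r P _ [ O0 oO _ bO] r0 extO projP.
have D0 := ediam_gt0 oO bO O0 projP.
split => [f f0 fL sigma fsigma|p f p1 f0 fL sigma fsigma].
  have [mf _] := (Lp_onP _ _ _).1 fL.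
  have [M0 fM foo] := Lp_on_pinfty_pos_restrict oO bO fL.
  have [s ds] := lebesgue_density_exists oO bO r0 O0 extO projP f0 mf fsigma foo.
  exists s => //.
  have := density_le_ae oO bO r0 O0 extO projP f0 mf fsigma foo ds M0 fM.
  apply: filterS => y sM Oy; apply: (le_trans (sM Oy)).
  have [bPy _] := projP.2 _ Oy.
  have B0 : boundary Omega !=set0 by exists (P y).
  have dD : edist_set y (boundary Omega) <= ediam Omega.
    rewrite (le_trans (edist_set_le B0 y bPy))// -(bdistE P Oy).
    exact: (bdist_le_ediam bO O0 projP).
  have d0 := edist_set_ge0 B0 y.
  have rd : 0 < r + edist_set y (boundary Omega) by rewrite ltr_pwDl.
  have C0 := ray_const_ge0 oO bO r0 O0 projP.
  rewrite ler_pdivlMr ?exprn_gt0//.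
  set M := fine _ in M0 *; set c := ray_const Omega r in C0 *.
  rewrite (_ : _ * M = M * c * (r + ediam Omega) ^+ d.-1); last first.
    by rewrite /c /ray_const /ray_section_const; ring.
  apply: ler_wpM2l; first exact: mulr_ge0.
  apply: lerXn2r; rewrite ?nnegrE ?(ltW rd)//.
    by rewrite addr_ge0// ltW.
  by rewrite lerD2l.
have p_cases : p = +oo%E \/ exists2 q : R, p = q%:E & 1 <= q.
  by case: p p1 {fL} => [q||//]; [rewrite lee_fin; right; exists q|left].
have [mf _] := (Lp_onP _ _ _).1 fL.
case: p_cases => [pE|[q pE q1]]; rewrite {}pE in p1 fL *.
  have [M0 fM foo] := Lp_on_pinfty_pos_restrict oO bO fL.
  have [s ds] := lebesgue_density_exists oO bO r0 O0 extO projP f0 mf fsigma foo.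
  exists s => //; have [ms s0 _] := ds.
  have mO : measurable Omega by exact: measurable_rV_open.
  apply/Lp_onP; split.
    by apply/(measurable_restrictT _ mO); exact: measurable_funTS.
  have sM := density_le_ae oO bO r0 O0 extO projP f0 mf fsigma foo ds M0 fM.
  have C0 := ray_const_ge0 oO bO r0 O0 projP.
  apply: (le_lt_trans (Lp_norm_on_pinfty_le _ _) (ltry _)).
    by rewrite lee_fin; apply: (mulr_ge0 M0 C0).
  apply: filterS sM => y sy; rewrite patchE; case: ifPn => [/set_mem Oy|_].
    by rewrite /= ger0_norm// lee_fin sy.
  by rewrite abse0 lee_fin mulr_ge0.
have [fpoo foo] := Lp_on_pos_restrict oO bO q1 fL.
have [s ds] := lebesgue_density_exists oO bO r0 O0 extO projP f0 mf fsigma foo.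
exists s => //; have [ms s0 _] := ds.
have mO : measurable Omega by exact: measurable_rV_open.
apply/Lp_on_finP => //; split.
  by apply/(measurable_restrictT _ mO); exact: measurable_funTS.
have := density_Lp_integral oO bO r0 O0 extO projP f0 mf fsigma foo q1 ds fpoo.
rewrite integral_mkcond => soo; apply: le_lt_trans soo; rewrite le_eqVlt; apply/orP; left.
apply/eqP; apply: eq_integral => y _.
rewrite !patchE; case: ifPn => _; first by rewrite ger0_norm.
by rewrite normr0 powR0// gt_eqF// (lt_le_trans ltr01).
Qed.
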